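(* Suppose $\boldsymbol{X}\in[q]^N$ is a sample from the Potts model $\mathbb{P}_{\beta,\boldsymbol{B}}$, where the coupling matrix $\boldsymbol{A}_N$ satisfies $\sup_{N\ge1}\max_{i\in[N]}\sum_{j=1}^Na_{ij}<\infty$ and $\liminf_{N\to\infty}\frac1N\sum_{1\le i,j\le N}a_{ij}>0$, and $(\beta,\boldsymbol{B})\in\Theta:=(0,\infty)\times\mathbb{R}^{q-1}$. Then: (a) The partial MPL estimator $\hat{\boldsymbol{B}}_N$ exists with probability $1-o(1)$ for all $(\beta,\boldsymbol{B})\in(0,\infty)\times\mathbb{R}^{q-1}$, and the partial MPL estimator $\hat\beta_N$ exists with probability $1-o(1)$ whenever $U_N(\boldsymbol{X})^{-1}=o_{\mathbb{P}}(\sqrt N)$. (b) The partial MPL estimator $\hat{\boldsymbol{B}}_N$ satisfies $\|\hat{\boldsymbol{B}}_N-\boldsymbol{B}\|_2=O_{\mathbb{P}}\left(\frac1{\sqrt N}\right)$. (c) If $U_N(\boldsymbol{X})^{-1}=o_{\mathbb{P}}(\sqrt N)$, then the partial MPL estimator $\hat\beta_N$ satisfies $$|\hat\beta_N-\beta|=O_{\mathbb{P}}\left(\frac1{\sqrt N\,U_N(\boldsymbol{X})}\right).$$ (d) Define $\beta_c:=q$ if $q\le2$, and $\beta_c:=\frac{2(q-1)}{q-2}\log(q-1)$ otherwise. If $\boldsymbol{B}\ne\boldsymbol 0$, or if $\boldsymbol{B}=\boldsymbol 0$ and $\beta\liminf_{N\to\infty}\frac{\mathbf 1'\boldsymbol{A}_N\mathbf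 1}{N}>\beta_c$, then $U_N(\boldsymbol{X})^{-1}=O_{\mathbb{P}}(1)$. In these cases, $\hat\beta_N$ is $\sqrt N$-consistent for $\beta$, i.e. $|\hat\beta_N-\beta|=O_{\mathbb{P}}(N^{-1/2})$. (e) Finally, for the Erdős–Rényi Potts model $\mathbb{P}^{\mathrm{ER}}_{\beta,\boldsymbol{B}}$ (for which $\lim_{N\to\infty}\frac{\mathbf 1'\boldsymbol{A}_N\mathbf 1}{N}=1$ almost surely), when $\boldsymbol{B}=\boldsymbol 0$ no sequence of estimators (functions of $(\boldsymbol{X},G)$) exists that is consistent for $\beta$ in the range $0<\beta<\beta_c$.
   Context: Fix an integer $q\ge2$ and write $[m]=\{1,\dots,m\}$; $\mathbf 1$ is the all-ones vector in $\mathbb{R}^N$. For each $N$, $\boldsymbol{A}_N=((a_{ij}))_{1\le i,j\le N}$ is a known symmetric matrix with zero diagonal and non-negative entries (deterministic in (a)–(d)). For $\beta>0$ and $\boldsymbol{B}=(B_1,\dots,B_{q-1})\in\mathbb{R}^{q-1}$, with the convention $B_q:=0$, the Potts model is the probability mass function on $[q]^N$ $$\mathbb{P}_{\beta,\boldsymbol{B}}(\boldsymbol{x})=\frac{1}{Z_N(\beta,\boldsymbol{B})}\exp\Big(\frac\beta2\sum_{1\le i,j\le N}a_{ij}\mathbf 1_{x_i=x_j}+\sum_{i=1}^N\sum_{r=1}^qB_r\mathbf 1_{x_i=r}\Big),$$ with $Z_N(\beta,\boldsymbol{B})$ the normalizing constant. Let $m_{i,r}(\boldsymbol{x}):=\sum_{j=1}^Na_{ij}\mathbf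 1_{x_j=r}$ and $$U_N(\boldsymbol{x}):=\frac1N\sum_{1\le r<s\le q}\sum_{i=1}^N(m_{i,r}(\boldsymbol{x})-m_{i,s}(\boldsymbol{x}))^2.$$ The log pseudo-likelihood is, for $(\beta,\boldsymbol{B})\in\mathbb{R}^q$ (with $B_q:=0$), $$\ell_N(\beta,\boldsymbol{B}):=\beta\sum_{i=1}^N\sum_{r=1}^qm_{i,r}(\boldsymbol{X})\mathbf 1_{X_i=r}+\sum_{i=1}^N\sum_{r=1}^qB_r\mathbf 1_{X_i=r}-\sum_{i=1}^N\log\Big(\sum_{r=1}^q\exp\{\beta m_{i,r}(\boldsymbol{X})+B_r\}\Big).$$ For fixed (known, true) $\boldsymbol{B}$, the partial MPL estimator $\hat\beta_N$ of $\beta$ is the unique maximizer over $\mathbb{R}$ of $\beta\mapsto\ell_N(\beta,\boldsymbol{B})$; for fixed (known, true) $\beta$, the partial MPL estimator $\hat{\boldsymbol{B}}_N$ of $\boldsymbol{B}$ is the unique maximizer over $\mathbb{R}^{q-1}$ of $\boldsymbol{B}\mapsto\ell_N(\beta,\boldsymbol{B})$; each ''exists'' if the unique maximizer exists (where it does not, it may be assigned an arbitrary value). $O_{\mathbb{P}},o_{\mathbb{P}}$ are as $N\to\infty$ under the true law; $1/0:=\infty$; $Y_N=O_{\mathbb{P}}(W_N)$ means $Y_N/W_N$ is tight. Erdős–Rényi Potts model: for fixed $p\in(0,1]$, $G=((g_{ij}))$ is the adjacency matrix of an Erdős–Rényi random graph $\mathcal{G}(N,p)$, $a_{ij}:=g_{ij}/(Np)$,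 and given $G$, $\boldsymbol{X}$ follows the Potts model above with this coupling matrix; $\mathbb{P}^{\mathrm{ER}}_{\beta,\boldsymbol{B}}$ is the joint law of $(\boldsymbol{X},G)$ on $[q]^N\times\{0,1\}^{\binom N2}$. A sequence of estimators is consistent for $\beta$ in a range if it converges in probability to $\beta$ under $\mathbb{P}^{\mathrm{ER}}_{\beta,\boldsymbol 0}$ for every $\beta$ in that range. *)

(* Defs.v *)
From HB Require Import structures.
From mathcomp Require Import all_boot all_order all_algebra.
From mathcomp Require Import all_classical all_reals all_analysis.

Set Implicit Arguments.
Unset Strict Implicit.
Unset Printing Implicit Defensive.

Import Order.TTheory GRing.Theory Num.Theory.
Import numFieldNormedType.Exports.

Local Open Scope classical_set_scope.
Local Open Scope ring_scope.

Section FiniteLaws.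
Variable R : realType.

Definition prob (T : finType) (P : T -> R) (E : set T) : R :=
  \sum_(x | x \in E) P x.

Variables (T : nat -> finType) (P : forall N, T N -> R).

(** The variables are extended-real valued, so that [Y] or [W] may be [+oo]
    (as [potts_Uinv] is when [potts_U] vanishes); in [\bar R], [0^-1 = +oo] and
    [+oo^-1 = 0].  All three notions are asymptotic in [N]: finitely many
    indices never matter. *)
Definition is_OP (Y W : forall N, T N -> \bar R) : Prop :=
  forall e : R, 0 < e -> exists M : R,
    \forall N \near \oo,
      prob (@P N) [set x | (M%:E < `| Y N x / W N x |)%E] <= e.

Definition is_oP (Y W : forall N, T N -> \bar R) : Prop :=
  forall e : R, 0 < e ->
    prob (@P N) [set x | (e%:E < `| Y N x / W N x |)%E] @[N --> \oo] --> (0 : R).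

Definition cvg_in_prob (Y : forall N, T N -> R) (l : R) : Prop :=
  forall e : R, 0 < e ->
    prob (@P N) [set x | e < `| Y N x - l |] @[N --> \oo] --> (0 : R).

End FiniteLaws.

Definition is_maximizer (R : realType) (D : Type) (f : D -> R) (d : D) : Prop :=
  forall d', f d' <= f d.

Definition l2norm (R : realType) (n : nat) (v : 'rV[R]_n) : R :=
  Num.sqrt (\sum_i v 0 i ^+ 2).

(** Colours are indexed from [0]: the colour [r] of [[q]] is the ordinal of
    value [r - 1], so the reference colour [q] (for which [B_q = 0]) is the
    ordinal of value [q.-1]. *)
Definition config (q N : nat) : finType := {ffun 'I_N -> 'I_q}.

Section Potts.
Variables (R : realType) (q N : nat).
Implicit Types (A : 'M[R]_N) (b : R) (B : 'rV[R]_q.-1) (x : config q N).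

Definition is_coupling A : Prop :=
  [/\ A^T = A, forall i, A i i = 0 & forall i j, 0 <= A i j].

(** [B_r] for every colour [r]; [insub] fails exactly when [r = q.-1]. *)
Definition ext_field B (r : 'I_q) : R :=
  if insub (r : nat) is Some i then B 0 (i : 'I_q.-1) else 0.

Definition potts_weight A b B x : R :=
  expR (b / 2 * (\sum_i \sum_j A i j * (x i == x j)%:R)
        + \sum_i \sum_r ext_field B r * (x i == r)%:R).

Definition potts_Z A b B : R := \sum_x potts_weight A b B x.

Definition potts A b B x : R := potts_weight A b B x / potts_Z A b B.

Definition locfield A x (i : 'I_N) (r : 'I_q) : R :=
  \sum_j A i j * (x j == r)%:R.

Definition potts_U A x : R :=
  N%:R^-1 * \sum_(r < q) \sum_(s < q | (r < s)%N) \sum_i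
    (locfield A x i r - locfield A x i s) ^+ 2.

Definition logPL A x b B : R :=
  b * (\sum_i \sum_r locfield A x i r * (x i == r)%:R)
  + \sum_i \sum_r ext_field B r * (x i == r)%:R
  - \sum_i ln (\sum_r expR (b * locfield A x i r + ext_field B r)).

Definition mxtotal A : R := \sum_i \sum_j A i j.

Definition MPLE_beta_exists A B x : Prop :=
  exists! b, is_maximizer (fun b => logPL A x b B) b.

Definition MPLE_B_exists A b x : Prop :=
  exists! B, is_maximizer (fun B => logPL A x b B) B.

(** A map is a version of the estimator when it returns the unique maximizer
    wherever there is one; its other values are arbitrary. *)
Definition is_MPLE_beta A B (bhat : config q N -> R) : Prop :=
  forall x, MPLE_beta_exists A B x ->
    is_maximizer (fun b => logPL A x b B) (bhat x).

Definition is_MPLE_B A b (Bhat : config q N -> 'rV[R]_q.-1) : Prop :=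
  forall x, MPLE_B_exists A b x ->
    is_maximizer (fun B => logPL A x b B) (Bhat x).

End Potts.

Definition potts_Uinv (R : realType) (q : nat) (A : forall N, 'M[R]_N)
    (N : nat) (x : config q N) : \bar R := ((potts_U (A N) x)%:E^-1)%E.

Definition beta_c (R : realType) (q : nat) : R :=
  if (q <= 2)%N then q%:R
  else 2 * (q%:R - 1) / (q%:R - 2) * ln (q%:R - 1).

Definition edge (N : nat) : finType := {e : 'I_N * 'I_N | (e.1 < e.2)%N}.

Definition graph (N : nat) : finType := {ffun edge N -> bool}.

Definition adj (N : nat) (G : graph N) (i j : 'I_N) : bool :=
  oapp G false (insub (i, j)) || oapp G false (insub (j, i)).

Section ErdosRenyi.
Variables (R : realType) (q N : nat).

Definition ER (p : R) (G : graph N) : R :=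
  \prod_(e : edge N) (if G e then p else 1 - p).

Definition ER_coupling (p : R) (G : graph N) : 'M[R]_N :=
  \matrix_(i, j) ((adj G i j)%:R / (N%:R * p)).

Definition ER_potts (p b : R) (B : 'rV[R]_q.-1)
    (z : config q N * graph N) : R :=
  ER p z.2 * potts (ER_coupling p z.2) b B z.1.

End ErdosRenyi.

(* Main.v *)
Require Import Defs.
From HB Require Import structures.
From mathcomp Require Import all_boot all_order all_algebra.
From mathcomp Require Import all_classical all_reals all_analysis.
From mathcomp Require Import ring lra.

Set Implicit Arguments.
Unset Strict Implicit.
Unset Printing Implicit Defensive.

Import Order.TTheory GRing.Theory Num.Theory.
Import numFieldNormedType.Exports.

Local Open Scope classical_set_scope.
Local Open Scope ring_scope.

(** Parts (a)-(c): the log pseudo-likelihood is concave, its score at the truth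
    is a sum of conditionally centred terms each depending on the coordinate
    [j] at order [A i j], so it has second moment [O(N)], while its curvature
    is at least of order [N] in the [B]-directions and of order [N * U] in the
    [beta]-direction.  On a sphere of radius [K / sqrt N], respectively
    [K / (sqrt N * U)], the quadratic term wins, so the unique maximizer exists
    and lies inside.

    Part (d): if [U] is small, the local fields are nearly independent of the
    colour.  When [B <> 0] the conditional colour frequencies are then close to
    the non-uniform [softmax B], contradicting the uniformity of the fields.
    When [B = 0] the energy is close to that of the disordered phase, and for
    [beta * theta > beta_c] a product measure has strictly larger Gibbs free
    energy.

    Part (e): the mass converges by a variance bound and Borel-Cantelli.  For
    the second claim two small values of [beta] suffice: there, exponential
    moments of both signs of the centred energy are bounded, so each model
    dominates a multiple of the [beta = 0] model off an event of probability
    [1/4]; two estimates that are both nearly right would then be nearly right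
    under the same law. *)

(** * Softmax and log-sum-exp *)

(** The quadratic lower bound on log-sum-exp is only local: it requires the fields to be perturbed
    by at most one. This shapes part (c): the radius [K / (sqrt N * U)] is random and usable only
    where it is small, and the assumption on the inverse of [U] says that it is small with high
    probability. The score bounds use the Gibbs measure only through its single-site conditional
    laws, so they hold at every temperature. In part (d), a product trial measure sees the coupling
    only through its total mass, the quantity that the hypothesis controls. In part (e), the
    obstacle is that the normalizing constant is itself a random function of the graph. Subtracting
    [1 / q] from each agreement indicator changes the energy by a function of the graph alone, which
    cancels in the law of the configuration given the graph. What remains has exponential moments
    bounded in [N]: independence of the edges reduces them to the squared norm of the colour counts
    around their mean, and a recursion over the spins bounds the exponential of that square. *)

Section ExpInequalities.
Variable R : realType.
Implicit Types u y : R.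

(** Square [1 + u / 2 <= expR (u / 2)]; the hypothesis keeps the left side non-negative. *)
Lemma expR_ge_quarter_sqr u : -2 <= u -> 1 + u + u ^+ 2 / 4 <= expR u.
Proof.
move=> u2; have -> : u = u / 2 + u / 2 by lra.
rewrite expRD -expr2.
have h := expR_ge1Dx (u / 2).
have h0 : 0 <= 1 + u / 2 by lra.
have : (1 + u / 2) ^+ 2 <= expR (u / 2) ^+ 2 by rewrite lerXn2r// nnegrE expR_ge0.
by apply: le_trans; nra.
Qed.

Lemma ln1D_ge u : 0 <= u <= 1 -> u / 2 <= ln (1 + u).
Proof.
case/andP=> u0 u1; have u1gt0 : 0 < 1 + u by lra.
have : ln (1 + u)^-1 <= (1 + u)^-1 - 1.
  have := @le_ln1Dx R ((1 + u)^-1 - 1).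
  by rewrite [1 + (_ - 1)]addrC subrK; apply; rewrite ltrBrDr addNr invr_gt0.
rewrite lnV ?posrE//; set l := ln _ => hl.
have : 1 - (1 + u)^-1 = u / (1 + u) by field; lra.
suff : u / 2 <= u / (1 + u) by lra.
by rewrite ler_wpM2l// lef_pV2 ?posrE; lra.
Qed.

(** From [expR u <= (1 - u)^-1], since [(1 - u) * (1 + u + 2 * u ^+ 2) = 1 + u ^+ 2 * (1 - 2 *
    u)]. *)
Lemma expR_le_quad u : u <= 2^-1 -> expR u <= 1 + u + 2 * u ^+ 2.
Proof.
move=> u2; have u1 : 0 < 1 - u by lra.
have h := expR_ge1Dx (- u); rewrite expRN in h.
have : expR u <= (1 - u)^-1 by rewrite -[expR u]invrK lef_pV2 ?posrE ?invr_gt0 ?expR_gt0.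
move=> /le_trans; apply.
rewrite -[leLHS]mul1r ler_pdivrMr//; nra.
Qed.

(** Keeping the linear term outside the exponential lets it vanish on averaging a centred variable,
    which leaves a Gaussian-type bound valid for every [u]. *)
Lemma expR_le_gauss u : expR u <= u + expR (2 * u ^+ 2).
Proof.
have h := expR_ge1Dx (2 * u ^+ 2).
have [u2|u2] := leP u 2^-1.
  by have := expR_le_quad u2; lra.
have : expR u <= expR (2 * u ^+ 2) by rewrite ler_expR; nra.
lra.
Qed.

End ExpInequalities.

Section Softmax.
Variables (R : realType) (q : nat).
Implicit Types (h v : 'I_q -> R) (r s : 'I_q).

Definition lse h : R := ln (\sum_r expR (h r)).
Definition softmax h r : R := expR (h r) / \sum_s expR (h s).
Definition smean h v : R := \sum_r softmax h r * v r.

Hypothesis q0 : (0 < q)%N.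

Lemma sum_expR_gt0 h : 0 < \sum_r expR (h r).
Proof.
rewrite (bigD1 (Ordinal q0))//= ltr_pwDl ?expR_gt0 ?sumr_ge0//.
Qed.

Lemma softmax_gt0 h r : 0 < softmax h r.
Proof. by rewrite divr_gt0 ?expR_gt0 ?sum_expR_gt0. Qed.

Lemma softmax_sum1 h : \sum_r softmax h r = 1.
Proof. by rewrite -mulr_suml divff// gt_eqF// sum_expR_gt0. Qed.

Lemma softmax_le1 h r : softmax h r <= 1.
Proof.
rewrite -(softmax_sum1 h) (bigD1 r)//= lerDl sumr_ge0// => i _.
exact/ltW/softmax_gt0.
Qed.

Lemma softmax_shift h c r : softmax (fun s => h s + c) r = softmax h r.
Proof.
rewrite /softmax expRD; under eq_bigr do rewrite expRD.
by rewrite -mulr_suml -mulf_div divff ?mulr1// gt_eqF ?expR_gt0.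
Qed.

(** The numerator and the denominator each change by a factor of at most [expR e]. *)
Lemma softmax_ratio h h' e r : (forall s, `|h s - h' s| <= e) ->
  expR (- (2 * e)) * softmax h r <= softmax h' r.
Proof.
move=> he; have lo s : expR (- e) * expR (h s) <= expR (h' s).
  by rewrite -expRD ler_expR; have := he s; rewrite ler_norml; lra.
have hi : \sum_s expR (h' s) <= expR e * \sum_s expR (h s).
  rewrite mulr_sumr ler_sum// => s _.
  by rewrite -expRD ler_expR; have := he s; rewrite ler_norml; lra.
rewrite /softmax ler_pdivlMr ?sum_expR_gt0//.
have -> : - (2 * e) = - e + - e by lra.
rewrite expRD; apply: le_trans (lo r).
have -> : expR (- e) * expR (- e) * (expR (h r) / (\sum_s expR (h s)))
    * (\sum_s expR (h' s)) = (expR (- e) * expR (h r)) *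
    (expR (- e) * ((\sum_s expR (h' s)) / \sum_s expR (h s))) by ring.
rewrite -[leRHS]mulr1 ler_wpM2l ?mulr_ge0 ?expR_ge0//.
by rewrite mulrA ler_pdivrMr ?sum_expR_gt0// mul1r mulrC expRN
  ler_pdivrMr ?expR_gt0// mulrC.
Qed.

Lemma softmax_lip h h' e r : (forall s, `|h s - h' s| <= e) ->
  `|softmax h r - softmax h' r| <= 2 * e.
Proof.
have key g g' : (forall s, `|g s - g' s| <= e) ->
    softmax g r - softmax g' r <= 2 * e.
  move=> hg; have e0 : 0 <= e := le_trans (normr_ge0 _) (hg r).
  have := softmax_ratio r hg; have := expR_ge1Dx (- (2 * e)).
  by have := softmax_gt0 g r; have := softmax_le1 g r; nra.
move=> he; rewrite ler_norml; apply/andP; split; last exact: key.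
by rewrite lerNl opprB; apply: key => s; rewrite distrC.
Qed.

Lemma softmax_ge h H r : (forall s, `|h s| <= H) ->
  expR (- (2 * H)) / q%:R <= softmax h r.
Proof.
move=> hH; have := @softmax_ratio (fun=> 0) h H r.
rewrite {1}/softmax expR0 sumr_const card_ord mul1r; apply=> s.
by rewrite add0r normrN.
Qed.

Lemma smeanD h v v' : smean h (fun r => v r + v' r) = smean h v + smean h v'.
Proof. by rewrite -big_split; apply: eq_bigr => r _; rewrite mulrDr. Qed.

Lemma smeanZ h c v : smean h (fun r => c * v r) = c * smean h v.
Proof. by rewrite mulr_sumr; apply: eq_bigr => r _; rewrite mulrCA. Qed.

Lemma smean_cst h c : smean h (fun=> c) = c.
Proof. by rewrite /smean -mulr_suml softmax_sum1 mul1r. Qed.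

Lemma ler_smean h v v' : (forall r, v r <= v' r) -> smean h v <= smean h v'.
Proof. by move=> vv'; apply: ler_sum => r _; rewrite ler_wpM2l// ltW// softmax_gt0. Qed.

Lemma smean_norm_le h v e : (forall r, `|v r| <= e) -> `|smean h v| <= e.
Proof.
move=> ve; rewrite ler_norml -{1}(smean_cst h (- e)) -{2}(smean_cst h e).
by rewrite !ler_smean// => r; have := ve r; rewrite ler_norml => /andP[].
Qed.

Lemma lseD h v : lse (fun r => h r + v r) = lse h + ln (smean h (expR \o v)).
Proof.
have -> : smean h (expR \o v) = (\sum_r expR (h r + v r)) / \sum_r expR (h r).
  by rewrite mulr_suml; apply: eq_bigr => r _; rewrite /= expRD mulrAC.
by rewrite ln_div ?posrE ?sum_expR_gt0// addrC subrK.
Qed.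

Lemma smean_expR_gt0 h v : 0 < smean h (expR \o v).
Proof.
rewrite /smean (bigD1 (Ordinal q0))//= ltr_wpDr//.
  by apply: sumr_ge0 => r _; rewrite mulr_ge0 ?expR_ge0// ltW// softmax_gt0.
by rewrite mulr_gt0 ?expR_gt0// softmax_gt0.
Qed.

Lemma lse_center h v :
  lse (fun r => h r + v r) =
  lse h + smean h v + ln (smean h (fun r => expR (v r - smean h v))).
Proof.
rewrite lseD -addrA; congr (_ + _); set m := smean h v.
have -> : smean h (expR \o v) = expR m * smean h (fun r => expR (v r - m)).
  by rewrite -smeanZ; apply: eq_bigr => r _; rewrite /= -expRD [m + _]addrC subrK.
by rewrite lnM ?posrE ?expR_gt0 ?expRK// (smean_expR_gt0 h (fun r => v r - m)).
Qed.

Lemma smean_center h v : smean h (fun r => v r - smean h v) = 0.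
Proof. by rewrite smeanD smean_cst subrr. Qed.

Lemma lse_ge h v : lse h + smean h v <= lse (fun r => h r + v r).
Proof.
rewrite lse_center lerDl ln_ge0//.
apply: (@le_trans _ _ (smean h (fun r => 1 + (v r - smean h v)))).
  by rewrite smeanD smean_cst smean_center addr0.
by apply: ler_smean => r; exact: expR_ge1Dx.
Qed.

(** A non-constant [v] differs from its mean at some colour, and there [1 + u < expR u] is
    strict. *)
Lemma lse_gt h v r s : v r != v s ->
  lse h + smean h v < lse (fun r => h r + v r).
Proof.
move=> vrs; rewrite lse_center ltrDl ln_gt0//.
apply: (@le_lt_trans _ _ (smean h (fun r => 1 + (v r - smean h v)))).
  by rewrite smeanD smean_cst smean_center addr0.
have [t vt] : exists t, v t != smean h v.
  by have [vr|?] := eqVneq (v r) (smean h v); [exists s; rewrite -vr eq_sym|exists r].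
rewrite /smean (bigD1 t)//= [ltRHS](bigD1 t)//= ltr_leD//.
  by rewrite ltr_pM2l ?softmax_gt0// expR_gt1Dx// subr_eq0.
apply: ler_sum => u _.
by rewrite ler_wpM2l// ?expR_ge1Dx// ltW// softmax_gt0.
Qed.

(** The inner double sum of [potts_U]. It vanishes exactly on constant [v], the directions in which
    [lse] is affine, so it measures the curvature that is available. *)
Definition spread v : R := \sum_(r < q) \sum_(s < q | (r < s)%N) (v r - v s) ^+ 2.

Lemma spread_ge0 v : 0 <= spread v.
Proof. by do 2!rewrite sumr_ge0// => ? _; rewrite sqr_ge0. Qed.

Lemma spreadZ c v : spread (fun r => c * v r) = c ^+ 2 * spread v.
Proof.
rewrite mulr_sumr; apply: eq_bigr => r _; rewrite mulr_sumr.
by apply: eq_bigr => s _; rewrite -mulrBr exprMn.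
Qed.

Lemma ge_spread v r s : (v r - v s) ^+ 2 <= spread v.
Proof.
wlog rs : r s / (r <= s)%N.
  move=> H; have [|/ltnW] := leqP r s; first exact: H.
  by rewrite -sqrrN opprB; exact: H.
have [->|rs'] := eqVneq r s; first by rewrite subrr expr0n spread_ge0.
have {rs rs'} rs : (r < s)%N by rewrite ltn_neqAle rs'.
rewrite /spread (bigD1 r)//= (bigD1 s)//= -addrA lerDl addr_ge0//.
  by rewrite sumr_ge0// => ? _; rewrite sqr_ge0.
by do 2!rewrite sumr_ge0// => ? _; rewrite sqr_ge0.
Qed.

Lemma spread_le v c : spread v <= 4 * q%:R * \sum_r (v r - c) ^+ 2.
Proof.
have le2 (r s : 'I_q) : (v r - v s) ^+ 2 <= 2 * (v r - c) ^+ 2 + 2 * (v s - c) ^+ 2.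
  have := sqr_ge0 (v r - c + (v s - c)); nra.
apply: (@le_trans _ _ (\sum_(r < q) \sum_(s < q) (2 * (v r - c) ^+ 2 + 2 * (v s - c) ^+ 2))).
  apply: ler_sum => r _; apply: (@le_trans _ _ (\sum_s (v r - v s) ^+ 2)).
    by rewrite [leRHS](bigID (fun s : 'I_q => (r < s)%N))/= lerDl sumr_ge0// => ? _; rewrite sqr_ge0.
  by apply: ler_sum => s _; exact: le2.
set S := \sum_r (v r - c) ^+ 2.
under eq_bigr do rewrite big_split/= sumr_const card_ord -mulr_sumr -/S -[_ *+ q]mulr_natl.
rewrite big_split/= sumr_const card_ord -[_ *+ q]mulr_natl -!mulr_sumr -/S.
by rewrite le_eqVlt; apply/orP; left; apply/eqP; ring.
Qed.

(** Strong convexity in the non-constant directions. Centred values lie in [[-2, 2]], so the mean of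
    their exponentials is at least [1 + V / 4] with variance [V <= 4], and its logarithm is at least
    [V / 8]. The variance is at least [m] times the sum of squared deviations, hence
    [m * spread v / (4 * q)]; this is the origin of [32]. *)
Lemma lse_ge_spread h v m : 0 < m -> (forall r, m <= softmax h r) ->
  (forall r, `|v r| <= 1) ->
  lse h + smean h v + m / (32 * q%:R) * spread v <= lse (fun r => h r + v r).
Proof.
move=> m0 hm v1; rewrite lse_center lerD2l; set a := smean h v.
have a1 : `|a| <= 1 := smean_norm_le h v1.
have u2 r : -2 <= v r - a <= 2.
  by have := v1 r; move: a1; rewrite !ler_norml; lra.
set V := smean h (fun r => (v r - a) ^+ 2).
have V4 : 0 <= V / 4 <= 1.
  have : 0 <= V by rewrite -(smean_cst h 0); apply: ler_smean => r; exact: sqr_ge0.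
  have : V <= 4 by rewrite -(smean_cst h 4); apply: ler_smean => r; have := u2 r; nra.
  lra.
have h1 : 1 + V / 4 <= smean h (fun r => expR (v r - a)).
  apply: (@le_trans _ _ (smean h (fun r => 1 + (v r - a) + 4^-1 * (v r - a) ^+ 2))).
    by rewrite smeanD smeanZ smeanD smean_cst smean_center addr0 mulrC -/V mulrC.
  by apply: ler_smean => r; rewrite mulrC expR_ge_quarter_sqr//; have := u2 r; lra.
have V10 : 0 < 1 + V / 4 by lra.
have h2 : ln (1 + V / 4) <= ln (smean h (fun r => expR (v r - a))).
  by rewrite ler_ln// posrE (lt_le_trans V10).
apply: le_trans h2; apply: le_trans (ln1D_ge V4).
have h3 : m * \sum_r (v r - a) ^+ 2 <= V.
  by rewrite mulr_sumr; apply: ler_sum => r _; rewrite ler_wpM2r ?sqr_ge0.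
have q0' : 0 < q%:R :> R by rewrite ltr0n.
have h4 := spread_le v a.
have : m / (32 * q%:R) * spread v <= m / (32 * q%:R) * (4 * q%:R * \sum_r (v r - a) ^+ 2).
  by rewrite ler_wpM2l// ltW// divr_gt0// mulr_gt0.
move=> /le_trans; apply.
have -> : m / (32 * q%:R) * (4 * q%:R * \sum_r (v r - a) ^+ 2)
  = (m * \sum_r (v r - a) ^+ 2) / 8 by field; lra.
lra.
Qed.

End Softmax.

(** * Second moments under Gibbs measures *)

Lemma ler_sum_ord (R : numDomainType) n (f : 'I_n -> R) c :
  (forall i, f i <= c) -> \sum_i f i <= n%:R * c.
Proof.
move=> fc; apply: (@le_trans _ _ (\sum_(i < n) c)); first exact: ler_sum.
by rewrite sumr_const card_ord mulr_natl.
Qed.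

Section Prob.
Variables (R : realType) (T : finType) (P : T -> R).
Hypothesis P0 : forall x, 0 <= P x.
Implicit Types E F : set T.

Lemma prob_ge0 E : 0 <= prob P E.
Proof. exact: sumr_ge0. Qed.

Lemma probE E : prob P E = \sum_x P x * (x \in E)%:R.
Proof.
rewrite /prob big_mkcond/=; apply: eq_bigr => x _.
by case: ifP; rewrite ?mulr1 ?mulr0.
Qed.

Lemma le_prob E F : E `<=` F -> prob P E <= prob P F.
Proof.
move=> EF; rewrite !probE; apply: ler_sum => x _; rewrite ler_wpM2l//.
by have [/set_mem/EF/mem_set ->|_] := boolP (x \in E); rewrite ?ler0n ?ler_nat.
Qed.

Lemma prob_setU_le E F : prob P (E `|` F) <= prob P E + prob P F.
Proof.
rewrite !probE -big_split/=; apply: ler_sum => x _; rewrite -mulrDr ler_wpM2l//.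
by rewrite in_setU; do 2!case: (_ \in _) => //=; rewrite ?addr0 ?add0r ?lerDl.
Qed.

Lemma prob_setT : prob P setT = \sum_x P x.
Proof. by rewrite probE; apply: eq_bigr => x _; rewrite in_setT mulr1. Qed.

Lemma prob_setC E : \sum_x P x = 1 -> prob P (~` E) = 1 - prob P E.
Proof.
move=> P1; apply/eqP; rewrite eq_sym subr_eq -P1 !probE -big_split/=; apply/eqP.
apply: eq_bigr => x _; rewrite -mulrDr in_setC.
by case: (_ \in _); rewrite ?addr0 ?add0r mulr1.
Qed.

Lemma prob_le1 E : \sum_x P x = 1 -> prob P E <= 1.
Proof. by move=> P1; rewrite -P1 -prob_setT le_prob. Qed.

Lemma prob_markov E (Y : T -> R) (t : R) : 0 < t -> (forall x, 0 <= Y x) ->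
  (forall x, E x -> t <= Y x) -> prob P E <= (\sum_x P x * Y x) / t.
Proof.
move=> t0 Y0 EY; rewrite ler_pdivlMr// probE mulr_suml; apply: ler_sum => x _.
rewrite -mulrA ler_wpM2l//.
by have [/set_mem/EY|_] := boolP (x \in E); rewrite ?mul1r ?mul0r.
Qed.

End Prob.

Section Resampling.
Variables (R : realType) (q N : nat).
Implicit Types (x : config q N) (i j : 'I_N) (r s : 'I_q) (w f : config q N -> R).

Definition upd x i r : config q N := [ffun j => if j == i then r else x j].

Lemma upd_same x i r : upd x i r i = r.
Proof. by rewrite ffunE eqxx. Qed.

Lemma upd_other x i r j : j != i -> upd x i r j = x j.
Proof. by rewrite ffunE => /negPf ->. Qed.

Lemma upd_id x i : upd x i (x i) = x.
Proof. by apply/ffunP => j; rewrite ffunE; case: eqP => [->|]. Qed.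

Lemma upd_upd x i r s : upd (upd x i r) i s = upd x i s.
Proof. by apply/ffunP => j; rewrite !ffunE; case: eqP. Qed.

(** Exchanging [r] with the colour of [i] in [x] is an involution on pairs [(x, r)], and it
    re-indexes the double sum. *)
Lemma sum_upd (F : config q N -> R) i :
  \sum_x \sum_r F (upd x i r) = q%:R * \sum_x F x.
Proof.
rewrite pair_bigA/=.
pose g (z : config q N * 'I_q) := (upd z.1 i z.2, z.1 i).
have gK : involutive g.
  by move=> [x r]; rewrite /g/= upd_upd upd_id upd_same.
rewrite (reindex_inj (inv_inj gK))/=.
under eq_bigr do rewrite /= upd_upd upd_id.
rewrite -(pair_bigA _ (fun x _ => F x))/= mulr_sumr.
by apply: eq_bigr => x _; rewrite sumr_const card_ord mulr_natl.
Qed.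

(** The first hypothesis says that [T] has conditional mean zero given the spins other than [i]; [f]
    depends on those spins only, so it is orthogonal to [T]. *)
Lemma sum_centered w f (T : config q N -> R) i : (0 < q)%N ->
  (forall x, \sum_r w (upd x i r) * T (upd x i r) = 0) ->
  (forall x r, f (upd x i r) = f x) ->
  \sum_x w x * (T x * f x) = 0.
Proof.
move=> q0 wT fi; apply: (@mulfI _ (q%:R : R)); first by rewrite pnatr_eq0 -lt0n.
rewrite mulr0 -(sum_upd _ i); apply: big1 => x _.
under eq_bigr do rewrite fi mulrA.
by rewrite -mulr_suml wT mul0r.
Qed.

(** Replacing [T j] by its value with coordinate [i] frozen at [r0] makes the
    off-diagonal term [(i, j)] vanish, at cost [e i j]. *)
Lemma second_moment_le w (T : 'I_N -> config q N -> R) K (e : 'I_N -> 'I_N -> R) r0 :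
  (forall x, 0 <= w x) -> 0 <= K -> (forall i j, 0 <= e i j) ->
  (forall i x, \sum_r w (upd x i r) * T i (upd x i r) = 0) ->
  (forall i x, `|T i x| <= K) ->
  (forall i j x r, j != i -> `|T j x - T j (upd x i r)| <= e i j) ->
  \sum_x w x * (\sum_i T i x) ^+ 2 <=
  (\sum_x w x) * (N%:R * K ^+ 2 + K * \sum_i \sum_j e i j).
Proof.
move=> w0 K0 e0 wT TK Te.
have q0 : (0 < q)%N by case: r0 => m /(leq_ltn_trans _)->.
have key i j : \sum_x w x * (T i x * T j x) <=
    \sum_x w x * ((i == j)%:R * K ^+ 2 + K * e i j).
  have [<-|ij] := eqVneq i j.
    apply: ler_sum => x _; rewrite ler_wpM2l// mul1r ler_wpDr ?mulr_ge0//.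
    by rewrite -expr2 -real_normK ?num_real// lerXn2r// nnegrE.
  pose f x := T j (upd x i r0).
  have fi x r : f (upd x i r) = f x by rewrite /f upd_upd.
  have -> : \sum_x w x * (T i x * T j x) =
      \sum_x w x * (T i x * (T j x - f x)) + \sum_x w x * (T i x * f x).
    by rewrite -big_split/=; apply: eq_bigr => x _; rewrite -!mulrDr subrK.
  rewrite (sum_centered q0 (wT i) fi) addr0 mul0r add0r.
  apply: ler_sum => x _; rewrite ler_wpM2l//.
  apply: le_trans (ler_norm _) _; rewrite normrM ler_pM//.
  by apply: Te; rewrite eq_sym.
have -> : \sum_x w x * (\sum_i T i x) ^+ 2 = \sum_i \sum_j \sum_x w x * (T i x * T j x).
  under [RHS]eq_bigr do rewrite exchange_big/=.
  rewrite [RHS]exchange_big/=; apply: eq_bigr => x _.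
  rewrite expr2 mulr_suml mulr_sumr; apply: eq_bigr => i _.
  by rewrite mulrA mulr_sumr; apply: eq_bigr => j _; rewrite mulrA.
apply: (@le_trans _ _ (\sum_i \sum_j (\sum_x w x) * ((i == j)%:R * K ^+ 2 + K * e i j))).
  by apply: ler_sum => i _; apply: ler_sum => j _; rewrite mulr_suml; exact: key.
under eq_bigr do rewrite -mulr_sumr.
rewrite -mulr_sumr ler_wpM2l ?sumr_ge0//.
under eq_bigr do rewrite big_split/= -mulr_suml -mulr_sumr.
rewrite big_split/= -mulr_sumr lerD2r -mulr_suml ler_wpM2r ?sqr_ge0//.
rewrite (eq_bigr (fun=> 1)) ?sumr_const ?card_ord// => i _.
rewrite (bigD1 i)//= eqxx big1 ?addr0// => j.
by rewrite eq_sym => /negPf ->.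
Qed.

End Resampling.

Section PottsScore.
Variables (R : realType) (q N : nat) (A : 'M[R]_N) (b : R) (B : 'rV[R]_q.-1).
Implicit Types (x : config q N) (i j : 'I_N) (r s : 'I_q).
Hypothesis Acpl : is_coupling A.

Let A_ge0 i j : 0 <= A i j. Proof. by case: Acpl. Qed.
Let A_diag i : A i i = 0. Proof. by case: Acpl. Qed.
Lemma coupling_sym i j : A i j = A j i.
Proof. by case: Acpl => AT _ _; rewrite -{1}AT mxE. Qed.

Definition hfield x i r : R := b * locfield A x i r + ext_field B r.

Lemma locfield_ge0 x i r : 0 <= locfield A x i r.
Proof. by apply: sumr_ge0 => j _; rewrite mulr_ge0. Qed.

Lemma locfield_sum x i : \sum_r locfield A x i r = \sum_j A i j.
Proof.
rewrite exchange_big/=; apply: eq_bigr => j _; rewrite -mulr_sumr.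
rewrite (bigD1 (x j))//= eqxx big1 ?addr0 ?mulr1// => r.
by rewrite eq_sym => /negPf ->.
Qed.

Lemma locfield_le x i r : locfield A x i r <= \sum_j A i j.
Proof.
by rewrite -(locfield_sum x) (bigD1 r)//= lerDl sumr_ge0// => s _; exact: locfield_ge0.
Qed.

Lemma locfield_upd_same x i r s : locfield A (upd x i r) i s = locfield A x i s.
Proof.
apply: eq_bigr => j _; have [->|ji] := eqVneq j i; first by rewrite A_diag !mul0r.
by rewrite upd_other.
Qed.

Lemma locfield_upd_lip x i j r s :
  `|locfield A x j s - locfield A (upd x i r) j s| <= A j i.
Proof.
rewrite -sumrB (bigD1 i)//= big1 ?addr0 => [|k ki]; last by rewrite upd_other ?subrr.
rewrite -mulrBr normrM ger0_norm// -[leRHS]mulr1 ler_wpM2l//.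
by do 2!case: eqP => _; rewrite ?subrr ?subr0 ?sub0r ?normrN ?normr1 ?normr0 ?ler01.
Qed.

Lemma hfield_upd_same x i r : hfield (upd x i r) i = hfield x i.
Proof. by apply/funext => s; rewrite /hfield locfield_upd_same. Qed.

Lemma hfield_upd_lip x i j r s : 0 <= b ->
  `|hfield x j s - hfield (upd x i r) j s| <= b * A j i.
Proof.
move=> b0; rewrite /hfield opprD addrACA subrr addr0 -mulrBr normrM ger0_norm//.
by rewrite ler_wpM2l// locfield_upd_lip.
Qed.

Lemma sum_pick (g : 'I_q -> R) s : \sum_r g r * (s == r)%:R = g s.
Proof.
rewrite (bigD1 s)//= eqxx mulr1 big1 ?addr0// => r; rewrite eq_sym => /negPf ->.
by rewrite mulr0.
Qed.

(** As [c] does not depend on [r], the conditional law of the spin at [i] is [softmax (hfield x i)].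
    By symmetry the row and the column through [i] contribute the same local field, which cancels
    the [1 / 2] of the energy. *)
Lemma potts_weight_upd x i :
  exists c, forall r, potts_weight A b B (upd x i r) = c * expR (hfield x i r).
Proof.
exists (expR (b / 2 * (\sum_(k | k != i) \sum_(j | j != i) A k j * (x k == x j)%:R)
  + \sum_(k | k != i) ext_field B (x k))) => r.
rewrite -expRD; congr expR.
have -> : \sum_k \sum_s ext_field B s * (upd x i r k == s)%:R =
    ext_field B r + \sum_(k | k != i) ext_field B (x k).
  under eq_bigr do rewrite sum_pick.
  by rewrite (bigD1 i)//= upd_same; congr (_ + _); apply: eq_bigr => k /upd_other ->.
have -> : \sum_k \sum_j A k j * (upd x i r k == upd x i r j)%:R =
    locfield A x i r + (locfield A x i r +
      \sum_(k | k != i) \sum_(j | j != i) A k j * (x k == x j)%:R).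
  rewrite (bigD1 i)//=; congr (_ + _).
    apply: eq_bigr => j _; have [->|ji] := eqVneq j i; first by rewrite A_diag !mul0r.
    by rewrite upd_same upd_other// eq_sym.
  have -> : locfield A x i r = \sum_(k | k != i) A k i * (x k == r)%:R.
    rewrite /locfield (bigD1 i)//= A_diag mul0r add0r.
    by apply: eq_bigr => k _; rewrite coupling_sym.
  rewrite -big_split/=; apply: eq_bigr => k ki.
  rewrite (bigD1 i)//= upd_same upd_other//; congr (_ + _).
  by apply: eq_bigr => j ji; rewrite upd_other.
by rewrite /hfield; field.
Qed.

Hypothesis q0 : (0 < q)%N.

Lemma potts_weight_gt0 x : 0 < potts_weight A b B x.
Proof. exact: expR_gt0. Qed.

Lemma potts_Z_gt0 : 0 < potts_Z A b B.
Proof.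
rewrite /potts_Z (bigD1 [ffun=> Ordinal q0])//= ltr_pwDl ?potts_weight_gt0//.
by apply: sumr_ge0 => x _; exact/ltW/potts_weight_gt0.
Qed.

Lemma potts_ge0 x : 0 <= potts A b B x.
Proof. by rewrite ltW// divr_gt0 ?potts_weight_gt0// potts_Z_gt0. Qed.

Lemma potts_sum1 : \sum_x potts A b B x = 1.
Proof. by rewrite -mulr_suml divff// gt_eqF// potts_Z_gt0. Qed.

(** With [c] a colour indicator or the local field, the sum over [i] is a partial derivative of
    [logPL] in [B] or in [b]. *)
Definition score (c : 'I_N -> config q N -> 'I_q -> R) x i : R :=
  c i x (x i) - smean (hfield x i) (c i x).

Lemma score_centered c x i : (forall r, c i (upd x i r) = c i x) ->
  \sum_r potts A b B (upd x i r) * score c (upd x i r) i = 0.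
Proof.
move=> ci; have [C hC] := potts_weight_upd x i.
set h := hfield x i; set m := smean h (c i x).
rewrite (eq_bigr (fun r => C / potts_Z A b B * (\sum_s expR (h s)) *
    (softmax h r * (c i x r - m)))).
  have h0 : \sum_r softmax h r * (c i x r - m) = 0 := smean_center q0 h (c i x).
  by rewrite -mulr_sumr h0 mulr0.
move=> r _; rewrite /score ci hfield_upd_same upd_same /potts hC -/h -/m /softmax.
by field; rewrite !gt_eqF ?potts_Z_gt0// sum_expR_gt0.
Qed.

(** [second_moment_le] with scores bounded by [2 * K]. Resampling spin [i] moves [c j] by at most
    [L * A j i], counted twice (the value and the mean), and the fields at [j] by [b * A j i], hence
    each of the [q] softmax weights by [2 * b * A j i]. The row sums then bound the double sum by
    [N * D]. *)
Lemma score_second_moment (c : 'I_N -> config q N -> 'I_q -> R) (K L D : R) :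
  0 <= b -> 0 <= K -> 0 <= L ->
  (forall i x r, c i (upd x i r) = c i x) ->
  (forall i x r, `|c i x r| <= K) ->
  (forall i j x r s, `|c j x s - c j (upd x i r) s| <= L * A j i) ->
  (forall i, \sum_j A i j <= D) ->
  \sum_x potts A b B x * (\sum_i score c x i) ^+ 2 <=
  N%:R * (4 * K ^+ 2 + 2 * K * (2 * L + q%:R * (2 * b * K)) * D).
Proof.
move=> b0 K0 L0 ci cK cL AD; pose M := 2 * L + q%:R * (2 * b * K).
have M0 : 0 <= M by rewrite addr_ge0 ?mulr_ge0.
have := @second_moment_le R q N (potts A b B) (fun i x => score c x i) (2 * K)
  (fun i j => M * A j i) (Ordinal q0) potts_ge0.
rewrite potts_sum1 mul1r; move=> /(_ _ _ _ _ _) H; apply: le_trans; first apply: H.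
- by rewrite mulr_ge0.
- by move=> i j; rewrite mulr_ge0.
- by move=> i x; exact: score_centered.
- move=> i x; rewrite /score; apply: le_trans (ler_normB _ _) _.
  have := smean_norm_le q0 (hfield x i) (cK i x); have := cK i x (x i); lra.
- move=> i j x r ji; rewrite /score upd_other//.
  set h := hfield x j; set h' := hfield _ j; set v := c j x; set v' := c j _.
  have -> : v (x j) - smean h v - (v' (x j) - smean h' v') =
     (v (x j) - v' (x j)) - (smean h (fun s => v s - v' s)
       + \sum_s (softmax h s - softmax h' s) * v' s).
    have -> : smean h v = smean h (fun s => v s - v' s) + smean h v'.
      by rewrite -smeanD; congr smean; apply/funext => s; rewrite subrK.
    have -> : smean h v' = \sum_s (softmax h s - softmax h' s) * v' s + smean h' v'.
      by rewrite -big_split/=; apply: eq_bigr => s _; rewrite -mulrDl subrK.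
    ring.
  apply: le_trans (ler_normB _ _) _.
  have h1 := cL i j x r (x j).
  have h2 : `|smean h (fun s => v s - v' s)| <= L * A j i.
    by apply: smean_norm_le => // s; exact: cL.
  have h3 : `|\sum_s (softmax h s - softmax h' s) * v' s| <= q%:R * (2 * (b * A j i) * K).
    apply: le_trans (ler_norm_sum _ _ _) _.
    apply: ler_sum_ord => s; rewrite normrM ler_pM//; last exact: cK.
    by apply: softmax_lip => // t; exact: hfield_upd_lip.
  have := ler_normD (smean h (fun s => v s - v' s)) (\sum_s (softmax h s - softmax h' s) * v' s).
  rewrite /M; rewrite -/v -/v' in h1; lra.
rewrite [X in _ <= _ * X](_ : _ = (2 * K) ^+ 2 + 2 * K * (M * D)); last by rewrite /M; ring.
rewrite [leRHS]mulrDr lerD2l mulrCA ler_wpM2l ?mulr_ge0//.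
rewrite exchange_big/=; apply: ler_sum_ord => j.
by rewrite -mulr_sumr ler_wpM2l.
Qed.

End PottsScore.

(** * Concave maximization and the pseudo-likelihood *)

Section ConcaveMax.
Variables (R : realType) (V : normedModType R) (f : V -> R) (G : V -> V -> R).
Variables (C : R) (v0 : V) (rho : R).
Hypothesis GZ : forall v t k, G v (t *: k) = t * G v k.
Hypothesis GC : forall v k, G v k <= C * `|k|.
Hypothesis f_lt : forall v k, k != 0 -> f (v + k) < f v + G v k.

Let G0 v : G v 0 = 0. Proof. by have := GZ v 0 0; rewrite scale0r mul0r. Qed.
Let GN v k : G v (- k) = - G v k. Proof. by rewrite -scaleN1r GZ mulN1r. Qed.

Let f_le v k : f (v + k) <= f v + G v k.
Proof. by have [->|/f_lt/ltW//] := eqVneq k 0; rewrite G0 !addr0. Qed.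

(** The supergradient inequality from both ends of a segment, with the uniform bound on [G], makes
    [f] Lipschitz. *)
Let f_cont : continuous f.
Proof.
have C0 : 0 <= Num.max C 1 by rewrite le_max ler01 orbT.
have lip v k : `|f v - f (v + k)| <= Num.max C 1 * `|k|.
  have h : C * `|k| <= Num.max C 1 * `|k| by rewrite ler_wpM2r// le_max lexx.
  rewrite ler_norml; have := f_le v k; have := f_le (v + k) (- k); rewrite addrK.
  by have := GC v k; have := GC (v + k) (- k); rewrite normrN; lra.
have C1 : 0 < Num.max C 1 by rewrite lt_max ltr01 orbT.
move=> v; apply/cvgrPdist_le => e e0; near=> w.
have := lip v (w - v); rewrite [v + _]addrC subrK => /le_trans; apply.
rewrite mulrC -ler_pdivlMr// distrC.
near: w; apply: cvgr_dist_le; first exact: cvg_id.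
by rewrite divr_gt0.
Unshelve. all: by end_near.
Qed.

(** At the midpoint the supergradients towards the two maximizers are opposite, so adding the two
    strict inequalities puts the midpoint above their average. *)
Lemma is_maximizer_unique v w : is_maximizer f v -> is_maximizer f w -> v = w.
Proof.
move=> vmax wmax; apply/eqP; apply: contraT => vw; rewrite -subr_eq0 in vw.
pose k := 2^-1 *: (v - w).
have k0 : k != 0 by rewrite scaler_eq0 negb_or vw andbT invr_eq0.
have vE : v = w + k + k.
  by rewrite -addrA -scalerDl (_ : _ + _ = 1) ?scale1r 1?addrC ?subrK//; lra.
have k0' : - k != 0 by rewrite oppr_eq0.
have := f_lt (w + k) k0; have := f_lt (w + k) k0'.
rewrite -vE addrK GN; have := vmax (w + k); have := wmax (w + k).
by lra.
Qed.

Hypothesis rho0 : 0 < rho.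
Hypothesis ball_compact : compact [set v | `|v - v0| <= rho].
Hypothesis sphere_lt : forall k, `|k| = rho -> f (v0 + k) < f v0.

(** The segment from [v0] to [v] meets the sphere at [w], where [f] is below [f v0]. The
    supergradient at [w] is therefore negative towards [v], and [f] keeps decreasing. *)
Let outside_lt v : rho < `|v - v0| -> f v < f v0.
Proof.
move=> vrho; have d0 : 0 < `|v - v0| := lt_trans rho0 vrho.
pose t := rho / `|v - v0|; have t0 : 0 < t by rewrite divr_gt0.
have t1 : t < 1 by rewrite ltr_pdivrMr ?mul1r.
pose d := v - v0; pose w := v0 + t *: d.
have : f w < f v0.
  by apply: sphere_lt; rewrite normrZ gtr0_norm// /t -mulrA mulVf ?mulr1// gt_eqF.
have w1 : w + (- t) *: d = v0 by rewrite /w scaleNr addrK.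
have w2 : w + (1 - t) *: d = v.
  by rewrite /w -addrA -scalerDl [t + _]addrC subrK scale1r /d [v0 + _]addrC subrK.
have := f_le w (- t *: d); have := f_le w ((1 - t) *: d).
by rewrite w1 w2 !GZ; set g := G w _; nra.
Qed.

(** Beating the sphere at the centre, a concave function beats everything
    outside the ball, so the maximum over the compact ball is global. *)
Lemma concave_max_in_ball :
  (exists! v, is_maximizer f v) /\
  (forall v, is_maximizer f v -> `|v - v0| <= rho).
Proof.
split; last first.
  by move=> v vmax; rewrite leNgt; apply/negP => /outside_lt; have := vmax v0; lra.
have [|c cball cmax] := compact_EVT_max _ ball_compact (continuous_subspaceT f_cont).
  by exists v0 => /=; rewrite subrr normr0 ltW.
have v0in : v0 \in [set v | `|v - v0| <= rho] by rewrite inE/= subrr normr0 ltW.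
have cm : is_maximizer f c.
  move=> v; have [vin|/outside_lt/ltW vout] := leP `|v - v0| rho.
    by apply: cmax; rewrite inE.
  by apply: le_trans vout _; exact: cmax.
by exists c; split => // w wm; exact: is_maximizer_unique.
Qed.

End ConcaveMax.

Section FieldPL.
Variables (R : realType) (q N : nat) (x : config q N).
Hypothesis q0 : (0 < q)%N.
Implicit Types (h v : 'I_N -> 'I_q -> R).

(** Both parameters enter [logPL] only through the fields, and affinely; as a function of the
    fields, one concavity estimate serves both estimators. *)
Definition fieldPL h : R := \sum_i (h i (x i) - lse (h i)).
Definition fieldPL_grad h v : R := \sum_i (v i (x i) - smean (h i) (v i)).

Lemma fieldPL_gradZ h t v :
  fieldPL_grad h (fun i r => t * v i r) = t * fieldPL_grad h v.
Proof. by rewrite mulr_sumr; apply: eq_bigr => i _; rewrite smeanZ mulrBr. Qed.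

Lemma fieldPL_grad_le h v e : (forall i r, `|v i r| <= e) ->
  fieldPL_grad h v <= N%:R * (2 * e).
Proof.
move=> ve; apply: ler_sum_ord => i; have := smean_norm_le q0 (h i) (ve i).
by have := ve i (x i); rewrite !ler_norml; lra.
Qed.

Lemma fieldPL_lt h v i r s : v i r != v i s ->
  fieldPL (fun i r => h i r + v i r) < fieldPL h + fieldPL_grad h v.
Proof.
move=> virs; rewrite -big_split/= /fieldPL (bigD1 i)//= [ltRHS](bigD1 i)//=.
rewrite ltr_leD//; first by have := lse_gt q0 (h i) virs; lra.
by apply: ler_sum => j _; have := lse_ge q0 (h j) (v j); lra.
Qed.

Lemma fieldPL_le_spread h v m : 0 < m -> (forall i r, m <= softmax (h i) r) ->
  (forall i r, `|v i r| <= 1) ->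
  fieldPL (fun i r => h i r + v i r) <=
  fieldPL h + fieldPL_grad h v - m / (32 * q%:R) * \sum_i spread (v i).
Proof.
move=> m0 hm v1; rewrite mulr_sumr -sumrN -!big_split/=; apply: ler_sum => i _.
by have := lse_ge_spread q0 m0 (hm i) (v1 i); lra.
Qed.

End FieldPL.

Section MPLE.
Variables (R : realType) (q N : nat) (A : 'M[R]_N) (x : config q N).
Hypothesis q0 : (0 < q)%N.
Implicit Types (b : R) (B : 'rV[R]_q.-1).

Lemma logPLE b B : logPL A x b B = fieldPL x (hfield A b B x).
Proof.
rewrite /logPL /fieldPL sumrB; congr (_ - _).
rewrite mulr_sumr -big_split/=; apply: eq_bigr => i _.
by rewrite !sum_pick.
Qed.

Lemma ext_fieldD B B' (r : 'I_q) : ext_field (B + B') r = ext_field B r + ext_field B' r.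
Proof. by rewrite /ext_field; case: insubP => [i _ _|_]; rewrite ?mxE ?addr0. Qed.

Lemma ext_fieldZ t B (r : 'I_q) : ext_field (t *: B) r = t * ext_field B r.
Proof. by rewrite /ext_field; case: insubP => [i _ _|_]; rewrite ?mxE ?mulr0. Qed.

Lemma ext_field_last B (r : 'I_q) : r = q.-1 :> nat -> ext_field B r = 0.
Proof. by rewrite /ext_field => ->; case: insubP => //= i; rewrite ltnn. Qed.

Lemma ext_field_ord B (r : 'I_q) (i : 'I_q.-1) : r = i :> nat -> ext_field B r = B 0 i.
Proof.
rewrite /ext_field => ->; case: insubP => [j _ ji|]; last by rewrite ltn_ord.
by congr (B _ _); apply: val_inj.
Qed.

Definition last_colour : 'I_q := Ordinal (eq_leq (prednK q0)).
Definition colour (i : 'I_q.-1) : 'I_q := Ordinal (leq_trans (ltn_ord i) (leq_pred q)).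

Lemma ext_field_colour B i : ext_field B (colour i) = B 0 i.
Proof. exact: ext_field_ord. Qed.

Lemma mx_norm_coord_le n (k : 'rV[R]_n) i : `|k 0 i| <= `|k|.
Proof.
rewrite [leRHS]/Num.norm /= mx_normrE; apply/bigmax_geP; right => /=.
by exists (0, i).
Qed.

Lemma mx_norm_le_coord n (k : 'rV[R]_n) e : 0 <= e ->
  (forall i, `|k 0 i| <= e) -> `|k| <= e.
Proof.
move=> e0 ke; rewrite [leLHS]/Num.norm /= mx_normrE; apply/bigmax_leP; split => // -[i j] _ /=.
by rewrite ord1.
Qed.

Lemma ext_field_norm_le B (r : 'I_q) : `|ext_field B r| <= `|B|.
Proof.
rewrite /ext_field; case: insubP => [i _ _|_]; last by rewrite normr0.
exact: mx_norm_coord_le.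
Qed.

(** Identifiability of [B]: the reference colour has field zero, so each coordinate of [B] is a
    difference of two field values. *)
Lemma ext_field_spread B : `|B| ^+ 2 <= spread (ext_field B : 'I_q -> R).
Proof.
rewrite -(sqr_sqrtr (spread_ge0 _)) lerXn2r ?nnegrE ?sqrtr_ge0//.
apply: mx_norm_le_coord => [|i]; first exact: sqrtr_ge0.
rewrite -sqrtr_sqr ler_wsqrtr//; have := ge_spread (ext_field B) (colour i) last_colour.
by rewrite ext_field_colour ext_field_last ?subr0.
Qed.

Lemma hfield_addB b B B' i r :
  hfield A b (B + B') x i r = hfield A b B x i r + ext_field B' r.
Proof. by rewrite /hfield ext_fieldD addrA. Qed.

Lemma hfield_addb b t B i r :
  hfield A (b + t) B x i r = hfield A b B x i r + t * locfield A x i r.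
Proof. by rewrite /hfield; ring. Qed.

Lemma sum_spread_locfield : (0 < N)%N ->
  \sum_i spread (locfield A x i) = N%:R * potts_U A x.
Proof.
move=> N0; rewrite /potts_U mulrA divff ?pnatr_eq0 -?lt0n// mul1r exchange_big/=.
by apply: eq_bigr => r _; rewrite exchange_big.
Qed.

(** On the sphere the linear term is at most [rho] times the summed scores and the curvature term is
    at least [m / (32 * q) * N * rho ^+ 2]. The condition [rho <= 1] keeps the perturbation in the
    range of [lse_ge_spread]. *)
Lemma MPLE_B_in_ball b B m rho : (0 < N)%N -> 0 < m ->
  (forall i r, m <= softmax (hfield A b B x i) r) ->
  0 < rho <= 1 ->
  \sum_s `|\sum_i score A b B (fun _ _ r => (r == s)%:R) x i| <
    m / (32 * q%:R) * (N%:R * rho) ->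
  MPLE_B_exists A b x /\
  (forall B', is_maximizer (fun B => logPL A x b B) B' -> `|B' - B| <= rho).
Proof.
move=> N0 m0 hm /andP[rho0 rho1] hS.
pose f := fun B => logPL A x b B.
pose G := fun B k => fieldPL_grad x (hfield A b B x) (fun _ => ext_field k).
have fD B1 k : f (B1 + k) = fieldPL x (fun i r => hfield A b B1 x i r + ext_field k r).
  by rewrite /f logPLE; congr fieldPL; apply/funext => i; apply/funext => r; exact: hfield_addB.
apply: (@concave_max_in_ball R _ f G (N%:R * 2)) => //.
- move=> v t k; rewrite /G -fieldPL_gradZ; congr fieldPL_grad.
  by apply/funext => _; apply/funext => r; exact: ext_fieldZ.
- by move=> v k; rewrite -mulrA; apply: fieldPL_grad_le => // i r; exact: ext_field_norm_le.
- move=> v k k0; rewrite fD /f logPLE.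
  have [i ki] : exists i, k 0 i != 0.
    apply/existsP; apply: contraR k0; rewrite negb_exists => /forallP k0.
    by apply/eqP/rowP => i; rewrite mxE; apply/eqP; rewrite -[_ == _]negbK k0.
  apply: (@fieldPL_lt _ _ _ _ _ _ _ (Ordinal N0) (colour i) last_colour) => //.
  by rewrite ext_field_colour ext_field_last.
- apply: bounded_closed_compact.
    exists (`|B| + rho); split; first exact: num_real.
    move=> M hM v /= vB; apply: ltW; apply: le_lt_trans hM.
    by rewrite -[v](subrK B); apply: le_trans (ler_normD _ _) _; rewrite addrC lerD2l.
  rewrite (_ : mkset _ = closed_ball_ Num.norm B rho); first exact: closed_closed_ball_.
  by apply/seteqP; split => v /=; rewrite distrC.
- move=> k krho; rewrite fD.
  apply: (le_lt_trans (@fieldPL_le_spread _ _ _ x q0 _ (fun=> ext_field k) _ m0 hm _)).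
    by move=> i r; apply: le_trans (ext_field_norm_le _ _) _; rewrite krho.
  rewrite /f logPLE -addrA gtrDl subr_lt0.
  have c0 : 0 < m / (32 * q%:R) by rewrite divr_gt0// mulr_gt0// ltr0n.
  have h1 : N%:R * rho ^+ 2 <= \sum_(i < N) spread (ext_field k : 'I_q -> R).
    rewrite sumr_const card_ord mulr_natl ler_wMn2r//.
    by rewrite -krho; exact: ext_field_spread.
  have h2 : fieldPL_grad x (hfield A b B x) (fun=> ext_field k) <=
     rho * \sum_s `|\sum_i score A b B (fun _ _ r => (r == s)%:R) x i|.
    (* By linearity, the derivative in direction [k] is a combination of the scores of the [q]
       colour indicators. *)
    have -> : fieldPL_grad x (hfield A b B x) (fun=> ext_field k) =
       \sum_s ext_field k s * \sum_i score A b B (fun _ _ r => (r == s)%:R) x i.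
      under [RHS]eq_bigr do rewrite mulr_sumr.
      rewrite [RHS]exchange_big/=; apply: eq_bigr => i _; rewrite /score.
      under [RHS]eq_bigr do rewrite mulrBr.
      rewrite sumrB sum_pick; congr (_ - _); rewrite /smean; apply: eq_bigr => s _.
      rewrite mulrC; congr (_ * _).
      by under eq_bigr do rewrite eq_sym; rewrite sum_pick.
    rewrite mulr_sumr; apply: ler_sum => s _; apply: le_trans (ler_norm _) _.
    by rewrite normrM ler_wpM2r// -krho; exact: ext_field_norm_le.
  apply: le_lt_trans h2 _; apply: (@lt_le_trans _ _ (m / (32 * q%:R) * (N%:R * rho ^+ 2))).
    by rewrite expr2 [X in _ < X](_ : _ = rho * (m / (32 * q%:R) * (N%:R * rho))) ?ltr_pM2l//; ring.
  by rewrite ler_wpM2l// ltW.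
Qed.

(** The direction is now the local field itself, whose total [spread] is [N * potts_U];
    [rho * D <= 1] keeps the perturbation of the fields below one. *)
Lemma MPLE_beta_in_ball b B m rho D : (0 < N)%N -> 0 < m ->
  (forall i r, m <= softmax (hfield A b B x i) r) ->
  (forall i r, `|locfield A x i r| <= D) ->
  0 < rho -> rho * D <= 1 ->
  `|\sum_i score A b B (fun i x => locfield A x i) x i| <
    m / (32 * q%:R) * (N%:R * potts_U A x * rho) ->
  MPLE_beta_exists A B x /\
  (forall b', is_maximizer (fun b => logPL A x b B) b' -> `|b' - b| <= rho).
Proof.
move=> N0 m0 hm AD rho0 rhoD hS.
have c0 : 0 < m / (32 * q%:R) by rewrite divr_gt0// mulr_gt0// ltr0n.
(* The strict bound on the score makes its right-hand side positive. *)
have U0 : 0 < potts_U A x.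
  have := le_lt_trans (normr_ge0 _) hS.
  by rewrite pmulr_rgt0// pmulr_lgt0// pmulr_rgt0// ltr0n.
pose f := fun b : R => logPL A x b B.
pose G := fun b k => fieldPL_grad x (hfield A b B x) (fun i r => k * locfield A x i r).
have fD b1 k : f (b1 + k) = fieldPL x (fun i r => hfield A b1 B x i r + k * locfield A x i r).
  by rewrite /f logPLE; congr fieldPL; apply/funext => i; apply/funext => r; exact: hfield_addb.
apply: (@concave_max_in_ball R R f G (N%:R * (2 * D))) => //.
- move=> v t k; rewrite /G -fieldPL_gradZ; congr fieldPL_grad.
  by apply/funext => i; apply/funext => r; rewrite mulrA.
- move=> v k; rewrite -!mulrA; apply: fieldPL_grad_le => // i r.
  by rewrite normrM mulrC ler_wpM2r.
- move=> v k k0; rewrite fD /f logPLE.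
  have [i [r [s irs]]] : exists i r s, locfield A x i r != locfield A x i s.
    apply: contrapT => H; move: U0.
    rewrite -(pmulr_rgt0 _ (_ : 0 < N%:R)) ?ltr0n// -sum_spread_locfield//.
    rewrite big1 ?ltxx// => i _; apply: big1 => r _; apply: big1 => s _.
    apply/eqP; rewrite sqrf_eq0 subr_eq0; apply/negPn/negP => irs.
    by apply: H; exists i, r, s.
  apply: (@fieldPL_lt _ _ _ _ _ _ _ i r s) => //.
  by apply: contra irs => /eqP/(mulfI k0) ->.
- rewrite (_ : mkset _ = `[b - rho, b + rho]%classic); first exact: segment_compact.
  by apply/seteqP; split => v /=; rewrite ler_distl in_itv.
- move=> k krho; rewrite fD.
  apply: (le_lt_trans (@fieldPL_le_spread _ _ _ x q0 _
    (fun i r => k * locfield A x i r) _ m0 hm _)).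
    by move=> i r; rewrite normrM krho (le_trans _ rhoD)// ler_wpM2l// ltW.
  rewrite /f logPLE -addrA gtrDl subr_lt0 fieldPL_gradZ.
  under eq_bigr do rewrite spreadZ.
  rewrite -mulr_sumr sum_spread_locfield// -[k ^+ 2]real_normK ?num_real// krho.
  apply: le_lt_trans (ler_norm _) _; rewrite normrM krho.
  rewrite [X in _ < X](_ : _ = rho * (m / (32 * q%:R) * (N%:R * potts_U A x * rho))); last by ring.
  by rewrite ltr_pM2l.
Qed.

End MPLE.

(** * Tightness of the estimators *)

Lemma row_sums_bounded (R : realType) (A : forall N, 'M[R]_N) :
  (forall N, is_coupling (A N)) ->
  (ereal_sup [set \big[maxe/-oo]_(i < N) (\sum_j A N i j)%:E
             | N in [set N | (1 <= N)%N]] < +oo)%E ->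
  exists2 D : R, 0 <= D & forall N i, \sum_j A N i j <= D.
Proof.
move=> Acpl; set s := ereal_sup _ => soo.
have le_s N i : ((\sum_j A N i j)%:E <= s)%E.
  apply: (@le_trans _ _ (\big[maxe/-oo]_(i < N) (\sum_j A N i j)%:E)%E).
    exact: (le_bigmax -oo%E (fun i => (\sum_j A N i j)%:E) i).
  apply: ereal_sup_ubound; exists N => //=; exact: leq_ltn_trans (ltn_ord i).
exists `|fine s| => // N i; have := le_s N i; move: soo.
by case: (s) => //= r _; rewrite lee_fin => /le_trans; apply; exact: ler_norm.
Qed.

Lemma limn_einf_gt_near (R : realType) (u : nat -> R) (l : R) :
  (l%:E < limn_einf (fun N => (u N)%:E))%E -> \forall N \near \oo, l <= u N.
Proof.
rewrite limn_einf_lim (cvg_lim _ (@cvg_einfs_sup _ _))// => /ereal_sup_gt[_ [n _ <-]] ln.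
exists n => // N /= nN; rewrite -lee_fin; apply/ltW/(lt_le_trans ln).
by apply: ereal_inf_lbound; exists N.
Qed.

Lemma cvg_prob1 (R : realType) (T : nat -> finType) (P : forall N, T N -> R)
    (E : forall N, set (T N)) :
  (forall N x, 0 <= P N x) -> (forall N, \sum_x P N x = 1) ->
  (forall e : R, 0 < e -> \forall N \near \oo, prob (P N) (~` E N) <= e) ->
  prob (P N) (E N) @[N --> \oo] --> (1 : R).
Proof.
move=> P0 P1 H; apply/cvgrPdist_le => e /H; apply: filterS => N.
by rewrite prob_setC// ger0_norm// subr_ge0 prob_le1.
Qed.

(** Covers [s = 0]: the rate is then [+oo] and both sides are [0]. *)
Lemma EFin_div_inve (R : realType) (y s : R) : (y%:E / (s%:E)^-1 = (y * s)%:E)%E.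
Proof. by rewrite inveK. Qed.

(** If [u = 0], the quotient is [+oo] and exceeds [e]; the bound therefore also yields
    positivity. *)
Lemma inve_div_le (R : realType) (u s e : R) : 0 <= u -> 0 < s -> 0 < e ->
  ~ (e%:E < `| (u%:E)^-1 / s%:E |)%E -> 0 < u /\ 1 <= e * (s * u).
Proof.
move=> u0 s0 e0 /negP; rewrite -leNgt [(s%:E^-1)%E]inver (gt_eqF s0) inver.
have [->|un0] := eqVneq u 0.
  by rewrite mulyr gtr0_sg ?invr_gt0// mul1e.
have {u0 un0} u0 : 0 < u by rewrite lt_neqAle eq_sym un0.
rewrite -EFinM abse_EFin lee_fin gtr0_norm ?mulr_gt0 ?invr_gt0// => h.
split=> //; rewrite -invfM in h.
by rewrite mulrC -ler_pdivrMl ?mulr1 ?mulr_gt0// mulrC.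
Qed.

Lemma sqrt_nat_near (R : realType) (K : R) : \forall N \near \oo, K <= Num.sqrt (N%:R : R).
Proof.
near=> N; apply: le_trans (ler_norm _) _; rewrite -sqrtr_sqr ler_wsqrtr//.
by near: N; exact: nbhs_infty_ger.
Unshelve. all: by end_near.
Qed.

Lemma l2norm_le (R : realType) n (v : 'rV[R]_n) : l2norm v <= n%:R * `|v|.
Proof.
case: n v => [|n] v; rewrite /l2norm; first by rewrite big_ord0 sqrtr0 mul0r.
have nv0 : 0 <= n.+1%:R * `|v| by rewrite mulr_ge0.
rewrite -[leRHS](ger0_norm nv0) -sqrtr_sqr ler_wsqrtr// exprMn.
apply: (@le_trans _ _ (n.+1%:R * `|v| ^+ 2)).
  apply: ler_sum_ord => i; rewrite -real_normK ?num_real//.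
  by rewrite lerXn2r ?nnegrE// mx_norm_coord_le.
by rewrite ler_wpM2r ?sqr_ge0// expr2 ler_peMr// ler1n.
Qed.

Section PottsSequence.
Variables (R : realType) (q : nat) (A : forall N, 'M[R]_N) (D b : R) (B : 'rV[R]_q.-1).
Hypothesis q0 : (0 < q)%N.
Hypothesis Acpl : forall N, is_coupling (A N).
Hypothesis D0 : 0 <= D.
Hypothesis AD : forall N i, \sum_j A N i j <= D.
Hypothesis b0 : 0 < b.

Let P N (x : config q N) : R := potts (A N) b B x.
Let P0 N x : 0 <= P x :> R := @potts_ge0 R q N (A N) b B q0 x.
Let P1 N : \sum_x @P N x = 1 := potts_sum1 (A N) b B q0.

Lemma locfield_norm_le N (x : config q N) i r : `|locfield (A N) x i r| <= D.
Proof.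
by rewrite ger0_norm ?(le_trans (locfield_le _ _ _ _))// ?(locfield_ge0 (Acpl N)).
Qed.

Lemma potts_U_ge0 N (x : config q N) : 0 <= potts_U (A N) x.
Proof.
rewrite mulr_ge0// ?invr_ge0//.
by do 3!(apply: sumr_ge0 => ? _); rewrite sqr_ge0.
Qed.

(** [b * D] plus the norm of [B] bounds all fields uniformly in [N] and [x]; this is the value that
    [softmax_ge] then gives. *)
Definition softmax_floor : R := expR (- (2 * (b * D + `|B|))) / q%:R.

Lemma softmax_floor_gt0 : 0 < softmax_floor.
Proof. by rewrite divr_gt0 ?expR_gt0// ltr0n. Qed.

Lemma softmax_floor_le N (x : config q N) i r :
  softmax_floor <= softmax (hfield (A N) b B x i) r.
Proof.
apply: softmax_ge => // s; apply: le_trans (ler_normD _ _) _.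
rewrite lerD ?ext_field_norm_le// normrM gtr0_norm// ler_wpM2l ?(ltW b0)//.
exact: locfield_norm_le.
Qed.

Definition moment_const (K L : R) : R :=
  4 * K ^+ 2 + 2 * K * (2 * L + q%:R * (2 * b * K)) * D.

(** The weights [d] are [1] for the estimation of [B], and the row sums of [A] in the lower bound on
    [potts_U] for a nonzero field. *)
Lemma score_indicator_moment (s : 'I_q) N (d : 'I_N -> R) K :
  0 <= K -> (forall i, `|d i| <= K) ->
  \sum_x @P N x * (\sum_i score (A N) b B (fun i _ r => d i * (r == s)%:R) x i) ^+ 2 <=
  N%:R * moment_const K 0.
Proof.
move=> K0 dK; apply: score_second_moment => //; first exact: ltW.
- move=> i x r; apply: le_trans (dK i); rewrite normrM ler_piMr// normr_nat.
  by case: (_ == _); rewrite ?lexx ?ler01.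
- by move=> i j x r t; rewrite subrr normr0 mul0r.
Qed.

Lemma score_locfield_moment N :
  \sum_x @P N x * (\sum_i score (A N) b B (fun i x => locfield (A N) x i) x i) ^+ 2 <=
  N%:R * moment_const D 1.
Proof.
apply: score_second_moment => //; first exact: ltW.
- by move=> i x r; apply/funext => s; rewrite locfield_upd_same.
- by move=> i x r; exact: locfield_norm_le.
- by move=> i j x r t; rewrite mul1r; exact: locfield_upd_lip.
Qed.

Lemma MPLE_B_tight (e : R) : 0 < e -> exists2 K : R, 0 < K &
  \forall N \near \oo, prob (@P N) (~` [set x | MPLE_B_exists (A N) b x /\
    forall B', is_maximizer (fun B => logPL (A N) x b B) B' ->
      `|B' - B| * Num.sqrt N%:R <= K]) <= e.
Proof.
move=> e0; set M := moment_const 1 0; pose c := softmax_floor / (32 * q%:R).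
have q0' : 0 < q%:R :> R by rewrite ltr0n.
have c0 : 0 < c by rewrite divr_gt0 ?softmax_floor_gt0 ?mulr_gt0.
(* The first summand absorbs the constant part of the AM-GM step below, the second makes the Markov
   bound at most [e]. *)
pose K1 := 2 * q%:R + 2 * q%:R * `|M| / e.
have K1q : 2 * q%:R <= K1 by rewrite lerDl !mulr_ge0// invr_ge0 ltW.
have K10 : 0 < K1 by apply: lt_le_trans K1q; rewrite mulr_gt0.
exists (K1 / c); first by rewrite divr_gt0.
near=> N.
have N0 : (0 < N)%N by near: N; exact: nbhs_infty_gt.
have sK : K1 / c <= Num.sqrt N%:R by near: N; exact: sqrt_nat_near.
have N0' : 0 < N%:R :> R by rewrite ltr0n.
set sN := Num.sqrt _ in sK *; have sN0 : 0 < sN by rewrite sqrtr_gt0.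
have sNN : sN * sN = N%:R by rewrite -expr2 sqr_sqrtr// ltW.
pose S s x := \sum_i score (A N) b B (fun _ _ r => (r == s)%:R) x i.
pose Y x := \sum_s S s x ^+ 2.
apply: (@le_trans _ _ ((\sum_x @P N x * Y x) / (K1 * N%:R / 2))); last first.
  have : \sum_x @P N x * Y x <= q%:R * (N%:R * `|M|).
    under eq_bigr do rewrite mulr_sumr.
    rewrite exchange_big/=; apply: ler_sum_ord => s.
    apply: (@le_trans _ _ (N%:R * M)); last by rewrite ler_wpM2l// ler_norm.
    apply: le_trans (@score_indicator_moment s N (fun=> 1) 1 ler01 _); last by rewrite normr1.
    rewrite le_eqVlt; apply/orP; left; apply/eqP; apply: eq_bigr => x _.
    congr (_ * _ ^+ 2); apply: eq_bigr => i _; congr (score _ _ _ _ _ _).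
    by do 3!(apply/funext => ?); rewrite mul1r.
  move=> h; rewrite ler_pdivrMr ?divr_gt0 ?mulr_gt0//; apply: (le_trans h).
  have : 2 * q%:R * `|M| <= K1 * e.
    by rewrite [leRHS]mulrDl divfK ?gt_eqF// lerDr !mulr_ge0// ltW.
  nra.
apply: prob_markov => //.
- by rewrite divr_gt0 ?mulr_gt0.
- by move=> x; apply: sumr_ge0 => s _; rewrite sqr_ge0.
move=> x /= bad; rewrite leNgt; apply/negP => hY; apply: bad.
have hS : \sum_s `|S s x| < c * (N%:R * (K1 / c / sN)).
  have -> : c * (N%:R * (K1 / c / sN)) = K1 * sN by rewrite -sNN; field; rewrite !gt_eqF.
  (* AM-GM at scale [sN] passes from the squares, which Markov controls, to absolute values. *)
  have : \sum_s `|S s x| <= \sum_s ((S s x) ^+ 2 / sN + sN) / 2.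
    apply: ler_sum => s _; rewrite ler_pdivlMr//.
    rewrite -[S s x ^+ 2]real_normK ?num_real//; set a := `|_|.
    rewrite -(ler_pM2r sN0) [leRHS]mulrDl divfK ?gt_eqF//.
    by have := sqr_ge0 (a - sN); nra.
  rewrite -mulr_suml big_split/= -mulr_suml sumr_const card_ord -/(Y x) -[_ *+ q]mulr_natl => h.
  have hY2 : Y x / sN < K1 * sN / 2.
    rewrite ltr_pdivrMr// (_ : K1 * sN / 2 * sN = K1 * N%:R / 2)//.
    by rewrite -sNN; ring.
  have hq : q%:R * sN <= K1 * sN / 2 by nra.
  have := mulr_gt0 K10 sN0.
  lra.
have [|ex] := MPLE_B_in_ball q0 N0 softmax_floor_gt0 (@softmax_floor_le N x) _ hS.
  apply/andP; split; first by do 2!rewrite divr_gt0//.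
  by rewrite ler_pdivrMr// mul1r.
by move=> h; split => // B' /h; rewrite ler_pdivlMr.
Unshelve. all: by end_near.
Qed.


Lemma potts_Uinv_oP_near (e d : R) :
  is_oP (T := config q) P (@potts_Uinv R q A) (fun N _ => (Num.sqrt N%:R)%:E) ->
  0 < e -> 0 < d ->
  \forall N \near \oo, prob (@P N) (~` [set x |
    0 < potts_U (A N) x /\ 1 <= d * (Num.sqrt N%:R * potts_U (A N) x)]) <= e.
Proof.
move=> UoP e0 d0; have /cvgrPdist_le/(_ e e0) := UoP d d0; apply: filterS2 (nbhs_infty_gt 0).
move=> N N0; rewrite sub0r normrN ger0_norm ?prob_ge0// => /(le_trans _); apply.
apply: le_prob => // x /= bad; rewrite ltNge; apply/negP => le; apply: bad.
apply: inve_div_le; rewrite ?potts_U_ge0 ?sqrtr_gt0 ?ltr0n//.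
by apply/negP; rewrite -leNgt.
Qed.

Lemma MPLE_beta_tight (e : R) :
  is_oP (T := config q) P (@potts_Uinv R q A) (fun N _ => (Num.sqrt N%:R)%:E) ->
  0 < e -> exists2 K : R, 0 < K &
  \forall N \near \oo, prob (@P N) (~` [set x | MPLE_beta_exists (A N) B x /\
    forall b', is_maximizer (fun b => logPL (A N) x b B) b' ->
      `|b' - b| * (Num.sqrt N%:R * potts_U (A N) x) <= K]) <= e.
Proof.
move=> UoP e0; set M := moment_const D 1; pose c := softmax_floor / (32 * q%:R).
have q0' : 0 < q%:R :> R by rewrite ltr0n.
have c0 : 0 < c by rewrite divr_gt0 ?softmax_floor_gt0 ?mulr_gt0.
(* [1 <= K1] gives [K1 * N <= (K1 * sN) ^+ 2], so the threshold [K1 * N] serves in Markov's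
   inequality; the second summand makes the bound at most [e / 2]. *)
pose K1 := 1 + 2 * `|M| / e.
have K11 : 1 <= K1 by rewrite lerDl !mulr_ge0// invr_ge0 ltW.
have K10 : 0 < K1 by apply: lt_le_trans K11.
exists (K1 / c); first by rewrite divr_gt0.
(* Chosen so that [1 <= d * (sqrt N * U)] forces radius times [D] to be at most one; the summand [1]
   keeps the inverse meaningful when [D = 0]. *)
pose d := (K1 / c * D + 1)^-1.
have d1 : 0 < K1 / c * D + 1 by rewrite ltr_wpDl// mulr_ge0// divr_ge0// ltW.
have d0 : 0 < d by rewrite invr_gt0.
have e20 : 0 < e / 2 by rewrite divr_gt0.
near=> N.
have N0 : (0 < N)%N by near: N; exact: nbhs_infty_gt.
have N0' : 0 < N%:R :> R by rewrite ltr0n.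
have hE2 : prob (@P N) (~` [set x | 0 < potts_U (A N) x /\
    1 <= d * (Num.sqrt N%:R * potts_U (A N) x)]) <= e / 2.
  by near: N; exact: potts_Uinv_oP_near.
set sN := Num.sqrt _ in hE2 *; have sN0 : 0 < sN by rewrite sqrtr_gt0.
have sNN : sN * sN = N%:R by rewrite -expr2 sqr_sqrtr// ltW.
pose S x := \sum_i score (A N) b B (fun i x => locfield (A N) x i) x i.
pose E1 := [set x | K1 * sN <= `|S x|].
set E2 := (X in prob _ X <= _) in hE2.
have hE1 : prob (@P N) E1 <= e / 2.
  apply: le_trans (@prob_markov _ _ _ (@P0 N) E1 (fun x => S x ^+ 2) (K1 * N%:R) _ _ _) _.
  - by rewrite mulr_gt0.
  - by move=> x; exact: sqr_ge0.
  - move=> x; rewrite /E1/= -[S x ^+ 2]real_normK ?num_real// => h.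
    have : (K1 * sN) ^+ 2 <= `|S x| ^+ 2 by rewrite lerXn2r// nnegrE mulr_ge0// ltW.
    apply: le_trans; rewrite -sNN; nra.
  rewrite ler_pdivrMr ?mulr_gt0//; apply: le_trans (score_locfield_moment N) _.
  have : 2 * `|M| <= K1 * e.
    by rewrite [leRHS]mulrDl divfK ?gt_eqF// lerDr mul1r ltW.
  by have := ler_norm M; rewrite -/M; nra.
apply: (@le_trans _ _ (prob (@P N) (E1 `|` E2))); last first.
  by apply: le_trans (prob_setU_le _ _ _) _ => //; lra.
apply: le_prob => // x /= bad; apply: contrapT => /not_orP[/negP + /contrapT[U0 hd]].
rewrite -ltNge => hS; apply: bad.
set U := potts_U _ _ in U0 hd *.
have sU0 : 0 < sN * U by rewrite mulr_gt0.
have hS' : `|S x| < c * (N%:R * U * (K1 / c / (sN * U))).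
  have -> : c * (N%:R * U * (K1 / c / (sN * U))) = K1 * sN.
    by rewrite -sNN; field; rewrite !gt_eqF.
  exact: hS.
have [||ex h] := MPLE_beta_in_ball q0 N0 softmax_floor_gt0 (@softmax_floor_le N x)
   (@locfield_norm_le N x) _ _ hS'.
- by do 2!rewrite divr_gt0//.
- rewrite mulrAC ler_pdivrMr// mul1r.
  move: hd; rewrite /d -(ler_pM2l d1) mulr1 mulVKf ?gt_eqF//; lra.
- by split => // b' /h; rewrite ler_pdivlMr.
Unshelve. all: by end_near.
Qed.

End PottsSequence.

(** * Lower bounds on the curvature *)

Lemma spread_mean (R : realType) q (v : 'I_q -> R) r : (0 < q)%N ->
  (v r - (\sum_s v s) / q%:R) ^+ 2 <= spread v.
Proof.
move=> q0; have q0' : 0 < q%:R :> R by rewrite ltr0n.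
rewrite -(sqr_sqrtr (spread_ge0 _)) -[leLHS]real_normK ?num_real//.
rewrite lerXn2r ?nnegrE ?sqrtr_ge0//.
have -> : v r - (\sum_s v s) / q%:R = (\sum_s (v r - v s)) / q%:R.
  rewrite sumrB sumr_const card_ord mulrBl -[v r *+ q]mulr_natr mulfK ?gt_eqF//.
rewrite normrM normfV (gtr0_norm q0') ler_pdivrMr// mulrC.
apply: le_trans (ler_norm_sum _ _ _) _; apply: ler_sum_ord => s.
by rewrite -sqrtr_sqr ler_wsqrtr// ge_spread.
Qed.

Section FlatFields.
Variables (R : realType) (q N : nat) (A : 'M[R]_N) (x : config q N) (eta : R).
Hypothesis q0 : (0 < q)%N.
Hypothesis eta0 : 0 < eta.
Hypothesis U_small : potts_U A x < eta ^+ 2.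

Definition row_sum (i : 'I_N) : R := \sum_j A i j.

(** [row_sum i / q] is the mean of the local fields at [i] over the colours. AM-GM at scale [eta]
    turns the quadratic control by [potts_U] into an absolute one. *)
Lemma locfield_flat r : \sum_i `|locfield A x i r - row_sum i / q%:R| <= N%:R * eta.
Proof.
have [N0|N0] := posnP N.
  rewrite big1 ?mulr_ge0 ?(ltW eta0)// => i _.
  by have := ltn_ord i; rewrite [X in (_ < X)%N]N0.
have N0' : 0 < N%:R :> R by rewrite ltr0n.
apply: (@le_trans _ _ (\sum_i ((spread (locfield A x i) / eta + eta) / 2))).
  apply: ler_sum => i _; rewrite ler_pdivlMr// -(ler_pM2r eta0).
  rewrite [leRHS]mulrDl divfK ?gt_eqF//.
  have := spread_mean (locfield A x i) r q0; rewrite locfield_sum -/(row_sum i).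
  set a := _ - _; rewrite -[a ^+ 2]real_normK ?num_real//.
  by have := sqr_ge0 (`|a| - eta); nra.
rewrite -mulr_suml big_split/= -mulr_suml sum_spread_locfield// sumr_const card_ord.
rewrite -[eta *+ N]mulr_natl.
have : N%:R * potts_U A x / eta <= N%:R * eta.
  by rewrite ler_pdivrMr// -mulrA ler_wpM2l ?ler0n// -expr2 ltW.
lra.
Qed.

End FlatFields.

Section FieldNonzero.
Variables (R : realType) (q : nat) (A : forall N, 'M[R]_N) (D b theta : R) (B : 'rV[R]_q.-1).
Hypothesis q0 : (0 < q)%N.
Hypothesis Acpl : forall N, is_coupling (A N).
Hypothesis D0 : 0 <= D.
Hypothesis AD : forall N i, \sum_j A N i j <= D.
Hypothesis b0 : 0 < b.
Hypothesis theta0 : 0 < theta.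
Hypothesis mass : \forall N \near \oo, theta <= mxtotal (A N) / N%:R.

Lemma softmax_nonuniform : B <> 0 ->
  exists r : 'I_q, softmax (ext_field B) r != q%:R^-1.
Proof.
move=> B0; apply: contrapT => H; apply: B0.
have unif r : softmax (ext_field B) r = q%:R^-1.
  by apply/eqP/negPn/negP => ?; apply: H; exists r.
apply/rowP => i; rewrite mxE -ext_field_colour.
have := unif (colour i); rewrite -(unif (last_colour q0)) /softmax.
move/mulIf => /(_ _)/expR_inj ->; rewrite ?invr_eq0 ?gt_eqF ?sum_expR_gt0//.
exact: ext_field_last.
Qed.

(** If the local fields are flat, the conditional law of each spin is close to
    [softmax B], whereas by symmetry of [A] the row-sum weighted count of the
    colour [r] is the sum of the flat fields, a fraction [1/q] of the mass. *)
Lemma score_row_sum_ge N (x : config q N) r eta : 0 < eta ->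
  potts_U (A N) x < eta ^+ 2 ->
  `|softmax (ext_field B) r - q%:R^-1| * mxtotal (A N) -
    N%:R * eta * (1 + 2 * b * D * q%:R) <=
  `|\sum_i score (A N) b B (fun i _ s => row_sum (A N) i * (s == r)%:R) x i|.
Proof.
move=> eta0 Ux; set sg := softmax _ r; set d := row_sum (A N).
have d0 i : 0 <= d i by apply: sumr_ge0 => j _; case: (Acpl N).
pose pi i := softmax (hfield (A N) b B x i) r.
have scoreE i : score (A N) b B (fun i _ s => d i * (s == r)%:R) x i =
    d i * (x i == r)%:R - d i * pi i.
  rewrite /score (smeanZ _ (d i) (fun s => (s == r)%:R)); congr (_ - _ * _).
  by rewrite /smean; under eq_bigr do rewrite eq_sym; rewrite sum_pick.
have sumE : \sum_i d i * (x i == r)%:R = \sum_i locfield (A N) x i r.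
  under eq_bigr do rewrite mulr_suml.
  rewrite exchange_big/=; apply: eq_bigr => i _; apply: eq_bigr => j _.
  by rewrite coupling_sym.
(* Adding the same constant to all colours leaves [softmax] unchanged, so only the deviation of the
   local fields from flatness counts. *)
have piE i : `|sg - pi i| <= 2 * (b * \sum_s `|locfield (A N) x i s - d i / q%:R|).
  rewrite /sg -(softmax_shift _ (b * (d i / q%:R))) distrC.
  apply: softmax_lip => // s.
  rewrite (_ : _ - _ = b * (locfield (A N) x i s - d i / q%:R)); last first.
    by rewrite /hfield; ring.
  rewrite normrM gtr0_norm// ler_pM2l// (bigD1 s)//= lerDl.
  exact: sumr_ge0.
under eq_bigr do rewrite scoreE.
rewrite sumrB sumE.
have -> : \sum_i locfield (A N) x i r - \sum_i d i * pi i =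
   (q%:R^-1 - sg) * mxtotal (A N) +
   (\sum_i (locfield (A N) x i r - d i / q%:R) + \sum_i d i * (sg - pi i)).
  rewrite /mxtotal mulr_sumr -!sumrB -!big_split/=; apply: eq_bigr => i _.
  by rewrite -/(row_sum (A N) i) -/d; ring.
set X := \sum_i (_ - _); set Y := \sum_i _ * _.
have hX : `|X| <= N%:R * eta.
  by apply: le_trans (ler_norm_sum _ _ _) _; exact: locfield_flat.
have hY : `|Y| <= 2 * b * D * (q%:R * (N%:R * eta)).
  apply: le_trans (ler_norm_sum _ _ _) _.
  apply: (@le_trans _ _ (\sum_i (2 * b * D) * \sum_s `|locfield (A N) x i s - d i / q%:R|)).
    apply: ler_sum => i _; rewrite normrM (ger0_norm (d0 i)).
    rewrite [leRHS](_ : _ = D * (2 * (b * \sum_s `|locfield (A N) x i s - d i / q%:R|))); last by ring.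
    by apply: ler_pM => //; exact: AD.
  rewrite -mulr_sumr exchange_big/= ler_wpM2l ?mulr_ge0 ?(ltW b0)//.
  by apply: ler_sum_ord => s; exact: locfield_flat.
have T0 : 0 <= mxtotal (A N) by apply: sumr_ge0 => i _; exact: d0.
have : `|(q%:R^-1 - sg) * mxtotal (A N)| = `|sg - q%:R^-1| * mxtotal (A N).
  by rewrite normrM distrC (ger0_norm T0).
have := lerB_normD ((q%:R^-1 - sg) * mxtotal (A N)) (X + Y).
have := ler_normD X Y.
lra.
Qed.

Lemma potts_U_lower_field : B <> 0 -> exists2 eta : R, 0 < eta &
  forall e : R, 0 < e -> \forall N \near \oo,
    prob (potts (A N) b B) [set x : config q N | potts_U (A N) x < eta ^+ 2] <= e.
Proof.
move=> /softmax_nonuniform[r]; rewrite -subr_eq0 -normr_gt0.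
set kap := `|_| => kap0; pose C := 1 + 2 * b * D * q%:R.
have C0 : 0 < C by rewrite ltr_wpDr// !mulr_ge0// ltW.
(* Makes the flatness error [N * eta * C] half of the main term [kap * theta * N]; the other half
   [N * w] bounds the score below, against a variance of order [N]. *)
pose eta := kap * theta / (2 * C).
have eta0 : 0 < eta by rewrite divr_gt0// mulr_gt0.
exists eta => // e e0; pose w := kap * theta / 2.
have w0 : 0 < w by rewrite divr_gt0// mulr_gt0.
pose M := moment_const q D b D 0.
near=> N.
have N0 : (0 < N)%N by near: N; exact: nbhs_infty_gt.
have N0' : 0 < N%:R :> R by rewrite ltr0n.
have mN : theta <= mxtotal (A N) / N%:R by near: N.
have NM : `|M| / (w ^+ 2 * e) <= N%:R by near: N; exact: nbhs_infty_ger.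
pose S (x : config q N) := \sum_i score (A N) b B (fun i _ s => row_sum (A N) i * (s == r)%:R) x i.
have P0 := @potts_ge0 R q N (A N) b B q0.
apply: le_trans (@prob_markov _ _ _ P0 _ (fun x => S x ^+ 2) ((N%:R * w) ^+ 2) _ _ _) _.
- by rewrite exprn_gt0// mulr_gt0.
- by move=> x; exact: sqr_ge0.
- move=> x /= Ux; rewrite -[S x ^+ 2]real_normK ?num_real//.
  have Nw0 : 0 <= N%:R * w by apply: mulr_ge0; rewrite ltW.
  rewrite lerXn2r ?nnegrE//.
  apply: le_trans (score_row_sum_ge r eta0 Ux); rewrite -/kap -/C.
  have -> : N%:R * eta * C = N%:R * w by rewrite /eta /w; field; rewrite gt_eqF.
  move: mN; rewrite ler_pdivlMr// => mN.
  by have := ler_wpM2l (ltW kap0) mN; rewrite /w; lra.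
rewrite ler_pdivrMr ?exprn_gt0 ?mulr_gt0//.
apply: le_trans (score_indicator_moment B q0 Acpl AD b0 r D0 _) _.
  move=> i; rewrite ger0_norm; first exact: AD.
  by apply: sumr_ge0 => j _; case: (Acpl N).
rewrite -/M; move: NM; rewrite ler_pdivrMr ?mulr_gt0 ?exprn_gt0// => NM.
have := ler_norm M; rewrite exprMn; nra.
Unshelve. all: by end_near.
Qed.

End FieldNonzero.

(** * Gibbs variational bound on the partition function *)

Section GibbsVariational.
Variables (R : realType) (q N : nat) (A : 'M[R]_N) (b : R) (B : 'rV[R]_q.-1).
Hypothesis q0 : (0 < q)%N.
Hypothesis Acpl : is_coupling A.

Let p (r : 'I_q) : R := softmax (ext_field B) r.
(** With zero coupling the Potts law is the product measure with marginals [p], so the resampling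
    identities compute its moments. *)
Let mu (x : config q N) : R := potts (0 : 'M[R]_N) 0 B x.

Let coupling0 : is_coupling (0 : 'M[R]_N).
Proof. by split=> [|i|i j]; rewrite ?trmx0 ?mxE. Qed.

Let mu1 : \sum_x mu x = 1 := potts_sum1 _ _ _ q0.
Let mu0 x : 0 <= mu x. Proof. exact: potts_ge0. Qed.

Let mu_pick i r (f : config q N -> R) : (forall x s, f (upd x i s) = f x) ->
  \sum_x mu x * ((x i == r)%:R * f x) = p r * \sum_x mu x * f x.
Proof.
move=> fi; pose c (j : 'I_N) (x : config q N) (s : 'I_q) : R := (s == r)%:R.
have ctr x : \sum_r mu (upd x i r) * score 0 0 B c (upd x i r) i = 0.
  exact: score_centered.
have h := @sum_centered _ _ _ mu f (fun x => score 0 0 B c x i) i q0 ctr fi.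
apply/eqP; rewrite -subr_eq0; apply/eqP; rewrite -[RHS]h mulr_sumr -sumrB.
apply: eq_bigr => x _; rewrite /score.
have -> : smean (hfield 0 0 B x i) (c i x) = p r.
  rewrite /smean; under eq_bigr do rewrite /c eq_sym; rewrite sum_pick.
  by congr softmax; apply/funext => s; rewrite /hfield mul0r add0r.
by rewrite /c; ring.
Qed.

Let mu_marginal i r : \sum_x mu x * (x i == r)%:R = p r.
Proof.
have := @mu_pick i r (fun=> 1) (fun _ _ => erefl).
by under eq_bigr do rewrite mulr1; under [in RHS]eq_bigr do rewrite mulr1; rewrite mu1 mulr1.
Qed.

Let mu_pair i j : i != j -> \sum_x mu x * (x i == x j)%:R = \sum_r p r ^+ 2.
Proof.
move=> ij.
have agreeE (x : config q N) : (x i == x j)%:R = \sum_r (x i == r)%:R * (x j == r)%:R :> R.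
  by rewrite sum_pick eq_sym.
under eq_bigr do rewrite agreeE mulr_sumr.
rewrite exchange_big/=; apply: eq_bigr => r _.
by rewrite mu_pick ?mu_marginal// => x s; rewrite upd_other// eq_sym.
Qed.

(** The Shannon entropy of [softmax (ext_field B)]. *)
Definition field_entropy : R :=
  lse (ext_field B : 'I_q -> R) - smean (ext_field B) (ext_field B : 'I_q -> R).

Lemma potts_Z_free : potts_Z (q := q) (0 : 'M[R]_N) 0 B =
  expR (N%:R * lse (ext_field B : 'I_q -> R)).
Proof.
rewrite expRM_natl lnK ?posrE ?sum_expR_gt0//.
have -> : (\sum_r expR (ext_field B r : R)) ^+ N =
    \prod_(i < N) \sum_(r < q) expR (ext_field B r).
  by rewrite prodr_const card_ord.
rewrite bigA_distr_bigA/=; apply: eq_bigr => x _.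
rewrite /potts_weight mul0r mul0r add0r expR_sum; apply: eq_bigr => i _.
by rewrite sum_pick.
Qed.

(** Jensen's inequality under [mu], via [1 + u <= expR u]: the log-density [g] has mean equal to
    energy plus entropy. The zero diagonal of [A] makes every pair that contributes independent
    under [mu]. *)
Lemma potts_Z_ge :
  expR (b / 2 * (mxtotal A * \sum_r p r ^+ 2) + N%:R * field_entropy) <=
  potts_Z (q := q) A b 0.
Proof.
pose H (x : config q N) := \sum_i \sum_j A i j * (x i == x j)%:R.
pose F (x : config q N) := \sum_i ext_field B (x i).
set l := lse (ext_field B : 'I_q -> R).
pose g x := b / 2 * H x - F x + N%:R * l.
have ZE : potts_Z (q := q) A b 0 = \sum_x mu x * expR (g x).
  apply: eq_bigr => x _; rewrite /mu /potts potts_Z_free -/l -expRN /potts_weight.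
  rewrite -!expRD; congr expR; rewrite !mul0r add0r -/(H x).
  rewrite [X in _ + X]big1 ?addr0 => [|i _]; last first.
    rewrite big1// => r _; rewrite /ext_field; case: insubP => [k _ _|_]; rewrite ?mxE mul0r//.
  under eq_bigr do rewrite sum_pick.
  by rewrite -/(F x) /g; ring.
set m := b / 2 * _ + _.
have Eg : \sum_x mu x * g x = m.
  have EH : \sum_x mu x * H x = mxtotal A * \sum_r p r ^+ 2.
    under eq_bigr do rewrite mulr_sumr.
    rewrite exchange_big/= mulr_suml; apply: eq_bigr => i _.
    under eq_bigr do rewrite mulr_sumr.
    rewrite exchange_big/= mulr_suml; apply: eq_bigr => j _.
    under eq_bigr do rewrite mulrCA.
    rewrite -mulr_sumr; have [->|ij] := eqVneq i j; last by rewrite mu_pair.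
    by case: Acpl => _ -> _; rewrite !mul0r.
  have EF : \sum_x mu x * F x = N%:R * smean (ext_field B) (ext_field B : 'I_q -> R).
    under eq_bigr do rewrite mulr_sumr.
    rewrite exchange_big/=.
    rewrite (eq_bigr (fun=> smean (ext_field B) (ext_field B : 'I_q -> R))).
      by rewrite sumr_const card_ord mulr_natl.
    move=> i _; rewrite /smean.
    under eq_bigr => x _ do rewrite -(sum_pick (ext_field B)) mulr_sumr.
    rewrite exchange_big/=; apply: eq_bigr => r _.
    under eq_bigr do rewrite mulrCA.
    by rewrite -mulr_sumr mu_marginal mulrC.
  under eq_bigr do rewrite /g mulrDr mulrBr mulrCA.
  rewrite big_split/= sumrB -mulr_sumr EH EF -mulr_suml mu1 mul1r /m /field_entropy -/l.
  by ring.
rewrite ZE -[expR m]mulr1.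
have -> : \sum_x mu x * expR (g x) = expR m * \sum_x mu x * expR (g x - m).
  rewrite mulr_sumr; apply: eq_bigr => x _.
  by rewrite mulrCA -expRD [m + _]addrC subrK.
rewrite ler_wpM2l ?expR_ge0//.
apply: (@le_trans _ _ (\sum_x mu x * (1 + (g x - m)))).
  under eq_bigr do rewrite addrA [1 + _]addrC -addrA mulrDr.
  by rewrite big_split/= Eg -mulr_suml mu1 mul1r addrC subrK.
by apply: ler_sum => x _; rewrite ler_wpM2l// expR_ge1Dx.
Qed.

End GibbsVariational.

(** * A symmetry-breaking product measure above [beta_c] *)

Section OrderedPhase.
Variables (R : realType).

(** Singles out one colour: for [2 <= q] and [0 < y], the marginals are proportional to
    [(y, 1, ..., 1)]. *)
Definition tilt (q : nat) (y : R) : 'rV[R]_q.-1 := \row_i (if i == 0 :> nat then ln y else 0).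

Lemma ext_field_tilt (q : nat) (y : R) (r : 'I_q) : (2 <= q)%N ->
  ext_field (tilt q y) r = if r == 0 :> nat then ln y else 0.
Proof.
move=> q2; rewrite /ext_field; case: insubP => [i _ <-|]; first by rewrite mxE.
by rewrite -leqNgt; case: eqP => // ->; case: (q) q2 => [|[|]].
Qed.

Lemma sum_tilt (q : nat) (y : R) (F : R -> R) : (2 <= q)%N ->
  \sum_(r < q) F (ext_field (tilt q y) r) = F (ln y) + (q%:R - 1) * F 0.
Proof.
move=> q2; case: q q2 => // q q2; rewrite big_ord_recl ext_field_tilt//=; congr (_ + _).
rewrite (eq_bigr (fun=> F 0)) => [|i _]; last by rewrite ext_field_tilt.
by rewrite sumr_const card_ord -natr1 addrK mulr_natl.
Qed.

Lemma tilt_partition (q : nat) (y : R) : (2 <= q)%N -> 0 < y ->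
  \sum_(r < q) expR (ext_field (tilt q y) r) = y + (q%:R - 1).
Proof. by move=> q2 y0; rewrite (sum_tilt _ expR)// lnK ?posrE// expR0 mulr1. Qed.

Lemma tilt_concentration (q : nat) (y : R) : (2 <= q)%N -> 0 < y ->
  \sum_(r < q) softmax (ext_field (tilt q y)) r ^+ 2 =
  (y ^+ 2 + (q%:R - 1)) / (y + (q%:R - 1)) ^+ 2.
Proof.
move=> q2 y0; under eq_bigr do rewrite /softmax tilt_partition// exprMn exprVn.
rewrite -mulr_suml (sum_tilt _ (fun z => expR z ^+ 2))// lnK ?posrE// expR0.
by rewrite expr1n mulr1.
Qed.

Lemma tilt_entropy (q : nat) (y : R) : (2 <= q)%N -> 0 < y ->
  @field_entropy R q (tilt q y) = ln (y + (q%:R - 1)) - y * ln y / (y + (q%:R - 1)).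
Proof.
move=> q2 y0; rewrite /field_entropy /lse /smean tilt_partition//; congr (_ - _).
under eq_bigr do rewrite /softmax tilt_partition// mulrAC.
by rewrite -mulr_suml (sum_tilt _ (fun z => expR z * z))// lnK ?posrE// mulr0 mulr0 addr0.
Qed.

Lemma ordered_phase_ising (t : R) : 2 < t -> exists B : 'rV[R]_(2.-1),
  0 < t / 2 * (\sum_(r < 2) softmax (@ext_field R 2 B) r ^+ 2 - 2^-1) +
      @field_entropy R 2 B - ln 2.
Proof.
move=> t2; have t0 : 0 < t by lra.
(* [x] is the magnetization: the marginals are [(1 + x) / 2] and [(1 - x) / 2]. The bounds below
   leave a gain of at least [x ^+ 2 / 4 * (t - 2 / (1 - x))], positive for [x] below [1 - 2 / t];
   half of that value is taken. *)
pose x : R := (1 - 2 / t) / 2.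
have x0 : 0 < x by rewrite divr_gt0// subr_gt0 ltr_pdivrMr// mul1r.
have x1 : x < 1 by have := divr_gt0 (ltr0Sn R 1) t0; rewrite /x; lra.
have xt : 2 < t * (1 - x).
  by rewrite (_ : t * _ = (t + 2) / 2) /x; [lra|field; rewrite gt_eqF].
have x1' : 0 < 1 - x by lra.
have x1'' : 0 < 1 + x by lra.
have y0 : 0 < (1 + x) / (1 - x) by rewrite divr_gt0.
exists (tilt 2 ((1 + x) / (1 - x))).
rewrite (@tilt_concentration 2)// (@tilt_entropy 2)//.
have -> : (1 + x) / (1 - x) + (2 - 1) = 2 / (1 - x) by field; lra.
rewrite !ln_div ?posrE//.
have hp : ln (1 + x) <= x by apply: le_ln1Dx; lra.
have hm : - ln (1 - x) <= x / (1 - x).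
  have e : 1 + x / (1 - x) = (1 - x)^-1 by field; lra.
  have := @le_ln1Dx R (x / (1 - x)); rewrite e lnV ?posrE//; apply.
  by have := divr_gt0 x0 x1'; lra.
have hq : ln (1 + x) + ln (1 - x) <= - x ^+ 2.
  rewrite -lnM ?posrE// (_ : _ * _ = 1 + - x ^+ 2); last by ring.
  by apply: le_ln1Dx; nra.
set lp := ln (1 + x) in hp hq *; set lm := ln (1 - x) in hm hq *.
have -> : t / 2 * ((((1 + x) / (1 - x)) ^+ 2 + (2 - 1)) / (2 / (1 - x)) ^+ 2 - 2^-1) +
  (ln 2 - lm - (1 + x) / (1 - x) * (lp - lm) / (2 / (1 - x))) - ln 2 =
  t * x ^+ 2 / 4 - (lp + lm) / 2 - x / 2 * (lp - lm) by field; lra.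
have h1 : x * (lp - lm) <= x * (x + x / (1 - x)) by rewrite ler_pM2l//; lra.
have h2 : x ^+ 2 / (1 - x) < t * x ^+ 2 / 2.
  by rewrite ltr_pdivrMr//; have := exprn_gt0 2 x0; nra.
have h3 : x * (x + x / (1 - x)) = x ^+ 2 + x ^+ 2 / (1 - x) by ring.
rewrite h3 in h1.
lra.
Qed.

Lemma ordered_phase_potts (q : nat) (t : R) : (3 <= q)%N -> beta_c R q < t ->
  exists B : 'rV[R]_q.-1,
  0 < t / 2 * (\sum_(r < q) softmax (ext_field B) r ^+ 2 - q%:R^-1) +
      @field_entropy R q B - ln q%:R.
Proof.
move=> q3; rewrite /beta_c leqNgt q3/= => ht.
have q3' : 3 <= q%:R :> R by rewrite (ler_nat _ 3).
have q10 : 0 < q%:R - 1 :> R by lra.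
have y0 : 0 < (q%:R - 1) ^+ 2 :> R by rewrite exprn_gt0.
(* This field has first marginal [(q - 1) / q], the magnetization at which
   the ordered and disordered phases coexist at [beta_c]. *)
exists (tilt q ((q%:R - 1) ^+ 2)).
rewrite tilt_concentration// 1?ltnW// tilt_entropy// 1?ltnW//.
have -> : (q%:R - 1) ^+ 2 + (q%:R - 1) = q%:R * (q%:R - 1) :> R by ring.
rewrite lnXn// lnM ?posrE//; last by lra.
set l := ln _ in ht *; set lq := ln q%:R; set Q : R := q%:R in q3' q10 ht *.
(* At this field the gain is exactly a positive multiple of [t] minus [beta_c]. *)
have -> : t / 2 * ((((Q - 1) ^+ 2) ^+ 2 + (Q - 1)) / (Q * (Q - 1)) ^+ 2 - Q^-1) +
   (lq + l - (Q - 1) ^+ 2 * (l *+ 2) / (Q * (Q - 1))) - lq =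
   (Q - 2) ^+ 2 / (2 * Q * (Q - 1)) * (t - 2 * (Q - 1) / (Q - 2) * l).
  by field; lra.
by rewrite mulr_gt0 ?subr_gt0// divr_gt0 ?exprn_gt0 ?mulr_gt0//; lra.
Qed.

Lemma ordered_phase (q : nat) (t : R) : (2 <= q)%N -> beta_c R q < t ->
  exists B : 'rV[R]_q.-1,
  0 < t / 2 * (\sum_(r < q) softmax (ext_field B) r ^+ 2 - q%:R^-1) +
      @field_entropy R q B - ln q%:R.
Proof.
rewrite leq_eqVlt => /orP[/eqP <-|]; last exact: ordered_phase_potts.
exact: ordered_phase_ising.
Qed.

Lemma beta_c_gt0 (q : nat) : (2 <= q)%N -> 0 < beta_c R q.
Proof.
move=> q2; rewrite /beta_c; case: ifP => [_|/negbT]; first by rewrite ltr0n ltnW.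
rewrite -ltnNge => q3; have q3' : 3 <= q%:R :> R by rewrite (ler_nat _ 3).
by rewrite mulr_gt0 ?ln_gt0 ?divr_gt0 ?mulr_gt0//; lra.
Qed.

End OrderedPhase.

Section FieldZero.
Variables (R : realType) (q : nat) (A : forall N, 'M[R]_N) (b theta : R).
Hypothesis q2 : (2 <= q)%N.
Hypothesis Acpl : forall N, is_coupling (A N).
Hypothesis b0 : 0 < b.
Hypothesis supercritical : beta_c R q < b * theta.
Hypothesis mass : \forall N \near \oo, theta <= mxtotal (A N) / N%:R.

Let q0 : (0 < q)%N := ltnW q2.
Let q0' : 0 < q%:R :> R. Proof. by rewrite ltr0n. Qed.

(** The interaction sums, over [i], the local field at the colour of [i]; a flat field contributes
    [row_sum i / q] whatever that colour is. *)
Lemma potts_weight_flat_le N (x : config q N) eta : 0 < eta ->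
  potts_U (A N) x < eta ^+ 2 ->
  potts_weight (A N) b 0 x <=
  expR (b / 2 * (mxtotal (A N) / q%:R + q%:R * (N%:R * eta))).
Proof.
move=> eta0 Ux; rewrite ler_expR.
rewrite [X in _ + X]big1 ?addr0 => [|i _]; last first.
  by rewrite big1// => r _; rewrite /ext_field; case: insubP => [k _ _|_]; rewrite ?mxE mul0r.
rewrite ler_wpM2l ?divr_ge0 ?(ltW b0)//.
apply: (@le_trans _ _ (\sum_i (row_sum (A N) i / q%:R +
    \sum_r `|locfield (A N) x i r - row_sum (A N) i / q%:R|))).
  apply: ler_sum => i _; under eq_bigr do rewrite eq_sym.
  rewrite -/(locfield (A N) x i (x i)) (bigD1 (x i))//= addrA ler_wpDr ?sumr_ge0//.
  by have := ler_norm (locfield (A N) x i (x i) - row_sum (A N) i / q%:R); lra.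
rewrite big_split/= -mulr_suml lerD2l exchange_big/=.
by apply: ler_sum_ord => r; exact: locfield_flat.
Qed.

(** On the event, the energy is that of the disordered phase, and the Gibbs
    variational bound with a tilted product measure makes it exponentially
    unlikely. *)
Lemma potts_U_lower_supercritical : exists2 eta : R, 0 < eta &
  forall e : R, 0 < e -> \forall N \near \oo,
    prob (potts (A N) b 0) [set x : config q N | potts_U (A N) x < eta ^+ 2] <= e.
Proof.
have [B] := ordered_phase q2 supercritical; set S2 := \sum_r _; set H := field_entropy _.
set g := _ - ln _ => g0; pose eta := g / (b * q%:R).
have eta0 : 0 < eta by rewrite divr_gt0// mulr_gt0.
(* Hence the gain increases with the mass, which may be replaced by its lower bound [theta * N]. The
   choice of [eta] lets the flatness error use up half of the gain [g]. *)
have S2q : 0 <= S2 - q%:R^-1.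
  have : 0 <= \sum_r (softmax (ext_field B : 'I_q -> R) r - q%:R^-1) ^+ 2.
    by apply: sumr_ge0 => r _; exact: sqr_ge0.
  under eq_bigr do rewrite sqrrB.
  rewrite big_split/= sumrB sumr_const card_ord sumrMnl -mulr_suml softmax_sum1//.
  rewrite -/S2 mul1r -[_ ^+ 2 *+ q]mulr_natl expr2 mulrA divff ?gt_eqF// mul1r; lra.
exists eta => // e e0; near=> N.
have N0 : (0 < N)%N by near: N; exact: nbhs_infty_gt.
have N0' : 0 < N%:R :> R by rewrite ltr0n.
have : theta <= mxtotal (A N) / N%:R by near: N.
rewrite ler_pdivlMr// => mN.
have NM : 2 / (g * e) <= N%:R by near: N; exact: nbhs_infty_ger.
set T := mxtotal (A N) in mN.
pose u := b / 2 * (T / q%:R + q%:R * (N%:R * eta)).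
pose v := b / 2 * (T * S2) + N%:R * H.
have Zv : expR v <= potts_Z (q := q) (A N) b 0 := potts_Z_ge b B q0 (Acpl N).
(* Union bound over the [q ^ N] configurations, with weight at most [expR u] on the event and
   partition function at least [expR v]. *)
apply: (@le_trans _ _ (expR (N%:R * ln q%:R + u - v))).
  apply: (@le_trans _ _ (\sum_(x : config q N) expR u / expR v)).
    rewrite /prob big_mkcond/=; apply: ler_sum => x _; case: ifPn => [|_]; last first.
      by rewrite divr_ge0 ?expR_ge0.
    rewrite inE/= => Ux; apply: ler_pM; rewrite ?invr_ge0 ?expR_ge0//.
    - by rewrite ltW// potts_Z_gt0.
    - exact: potts_weight_flat_le.
    - by rewrite lef_pV2 ?posrE ?expR_gt0// potts_Z_gt0.
  rewrite sumr_const card_ffun !card_ord -[leLHS]mulr_natl (expRB _ v) (expRD _ u).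
  by rewrite expRM_natl lnK ?posrE// natrX mulrA.
have uv : N%:R * ln q%:R + u - v <= - (N%:R * (g / 2)).
  have -> : N%:R * ln q%:R + u - v = - (b / 2 * (S2 - q%:R^-1) * T + N%:R * (H - ln q%:R) - N%:R * (g / 2)).
    by rewrite /u /v /eta; field; rewrite !gt_eqF.
  rewrite lerN2 lerBrDr.
  have -> : N%:R * (g / 2) + N%:R * (g / 2) = b / 2 * (S2 - q%:R^-1) * (theta * N%:R) + N%:R * (H - ln q%:R).
    by rewrite /g; field; rewrite gt_eqF.
  by rewrite lerD2r ler_wpM2l// mulr_ge0// divr_ge0// ltW.
apply: (@le_trans _ _ (expR (- (N%:R * (g / 2))))); first by rewrite ler_expR.
rewrite expRN -[leRHS]invrK lef_pV2 ?posrE ?invr_gt0 ?expR_gt0//.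
have := expR_ge1Dx (N%:R * (g / 2)).
apply: le_trans; move: NM; rewrite ler_pdivrMr ?mulr_gt0// => NM.
rewrite -[leLHS]mul1r ler_pdivrMr//; nra.
Unshelve. all: by end_near.
Qed.

End FieldZero.

(** * Rates of convergence from the tightness estimates *)

Lemma is_OP_inve (R : realType) (T : nat -> finType) (P : forall N, T N -> R)
    (y s : forall N, T N -> R) :
  (forall N x, 0 <= P N x) -> (forall N x, 0 <= y N x) -> (forall N x, 0 <= s N x) ->
  (forall e : R, 0 < e -> exists K : R, \forall N \near \oo,
    prob (P N) (~` [set x | y N x * s N x <= K]) <= e) ->
  is_OP P (fun N x => (y N x)%:E) (fun N x => ((s N x)%:E^-1)%E).
Proof.
move=> P0 y0 s0 H e /H[K HK]; exists K; apply: filterS HK => N; apply: le_trans.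
apply: le_prob => // x /=; rewrite EFin_div_inve abse_EFin lte_fin.
by rewrite ger0_norm ?mulr_ge0// ltNge => /negP.
Qed.

Section Consistency.
Variables (R : realType) (q : nat) (A : forall N, 'M[R]_N) (D b : R) (B : 'rV[R]_q.-1).
Hypothesis q0 : (0 < q)%N.
Hypothesis Acpl : forall N, is_coupling (A N).
Hypothesis D0 : 0 <= D.
Hypothesis AD : forall N i, \sum_j A N i j <= D.
Hypothesis b0 : 0 < b.

Let P N (x : config q N) : R := potts (A N) b B x.
Let P0 N x : 0 <= P x :> R := @potts_ge0 R q N (A N) b B q0 x.
Let P1 N : \sum_x @P N x = 1 := potts_sum1 (A N) b B q0.
Let Uinv_oP := is_oP (T := config q) P (@potts_Uinv R q A) (fun N _ => (Num.sqrt N%:R)%:E).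

Lemma MPLE_B_exists_cvg :
  prob (@P N) [set x | MPLE_B_exists (A N) b x] @[N --> \oo] --> (1 : R).
Proof.
apply: cvg_prob1 => // e e0.
have [K K0] := MPLE_B_tight B q0 Acpl AD b0 e0; apply: filterS => N; apply: le_trans.
by apply: le_prob => // x /= nex [].
Qed.

Lemma MPLE_B_rate (Bhat : forall N, config q N -> 'rV[R]_q.-1) :
  (forall N, is_MPLE_B (A N) b (Bhat N)) ->
  is_OP (T := config q) P (fun N x => (l2norm (Bhat N x - B))%:E)
    (fun N _ => ((Num.sqrt N%:R)%:E^-1)%E).
Proof.
move=> hB; apply: (@is_OP_inve _ _ _ _ (fun N _ => Num.sqrt N%:R)) => // [N x|e e0].
  exact: sqrtr_ge0.
have [K K0 HK] := MPLE_B_tight B q0 Acpl AD b0 e0.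
exists (q.-1%:R * K); apply: filterS HK => N; apply: le_trans.
apply: le_prob => // x /= bad [ex hx]; apply: bad.
apply: le_trans (ler_wpM2r (sqrtr_ge0 _) (l2norm_le _)) _.
by rewrite -mulrA ler_wpM2l//; apply: hx; exact: hB.
Qed.

Lemma MPLE_beta_exists_cvg : Uinv_oP ->
  prob (@P N) [set x | MPLE_beta_exists (A N) B x] @[N --> \oo] --> (1 : R).
Proof.
move=> UoP; apply: cvg_prob1 => // e e0.
have [K K0] := MPLE_beta_tight q0 Acpl D0 AD b0 UoP e0; apply: filterS => N; apply: le_trans.
by apply: le_prob => // x /= nex [].
Qed.

Lemma MPLE_beta_rate (bhat : forall N, config q N -> R) : Uinv_oP ->
  (forall N, is_MPLE_beta (A N) B (bhat N)) ->
  is_OP (T := config q) P (fun N x => (`| bhat N x - b |)%:E)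
    (fun N x => ((Num.sqrt N%:R * potts_U (A N) x)%:E^-1)%E).
Proof.
move=> UoP hb.
apply: (@is_OP_inve _ _ _ _ (fun N x => Num.sqrt N%:R * potts_U (A N) x)) => // [N x|e e0].
  by rewrite mulr_ge0 ?sqrtr_ge0 ?potts_U_ge0.
have [K K0 HK] := MPLE_beta_tight q0 Acpl D0 AD b0 UoP e0.
exists K; apply: filterS HK => N; apply: le_trans.
by apply: le_prob => // x /= bad [ex hx]; apply: bad; apply: hx; exact: hb.
Qed.

Hypothesis U_lower : exists2 eta : R, 0 < eta &
  forall e : R, 0 < e -> \forall N \near \oo,
    prob (@P N) [set x : config q N | potts_U (A N) x < eta ^+ 2] <= e.

Lemma potts_Uinv_OP1 : is_OP (T := config q) P (@potts_Uinv R q A) (fun N _ => 1%E).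
Proof.
have [eta eta0 HU] := U_lower => e /HU HUe; exists (eta ^- 2).
apply: filterS HUe => N; apply: le_trans; apply: le_prob => // x /=.
rewrite inve1 mule1 /potts_Uinv inver; case: eqVneq => [-> _|Un0].
  by rewrite exprn_gt0.
have U0 : 0 < potts_U (A N) x by rewrite lt_neqAle eq_sym Un0 potts_U_ge0.
rewrite abse_EFin lte_fin gtr0_norm ?invr_gt0//.
by rewrite ltf_pV2 ?posrE// exprn_gt0.
Qed.

Lemma potts_Uinv_oP : Uinv_oP.
Proof.
have [eta eta0 HU] := U_lower => d d0; apply/cvgrPdist_le => e /HU HUe.
apply: filterS3 HUe (nbhs_infty_gt 0) (sqrt_nat_near (d * eta ^+ 2)^-1) => N + N0 sK.
have sN0 : 0 < Num.sqrt N%:R :> R by rewrite sqrtr_gt0 ltr0n.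
rewrite sub0r normrN ger0_norm ?prob_ge0//.
apply: le_trans; apply: le_prob => // x /= hx; rewrite ltNge; apply/negP => Ueta.
have eta20 : 0 < eta ^+ 2 by rewrite exprn_gt0.
have U0 := lt_le_trans eta20 Ueta.
move: hx; rewrite /potts_Uinv; move: (potts_U _ _) Ueta U0 => U Ueta U0.
rewrite !inver !gt_eqF// -EFinM abse_EFin lte_fin.
rewrite gtr0_norm ?mulr_gt0 ?invr_gt0// -invfM; apply/negP; rewrite -leNgt.
rewrite invf_ple ?posrE ?mulr_gt0//.
apply: (@le_trans _ _ (eta ^+ 2 * (d * eta ^+ 2)^-1)).
  by rewrite invfM mulrCA divff ?mulr1// gt_eqF.
by apply: ler_pM => //; rewrite ltW// invr_gt0 mulr_gt0.
Qed.

Lemma MPLE_beta_sqrt_rate (bhat : forall N, config q N -> R) :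
  (forall N, is_MPLE_beta (A N) B (bhat N)) ->
  is_OP (T := config q) P (fun N x => (`| bhat N x - b |)%:E)
    (fun N _ => ((Num.sqrt N%:R)%:E^-1)%E).
Proof.
have [eta eta0 HU] := U_lower => hb.
apply: (@is_OP_inve _ _ _ _ (fun N _ => Num.sqrt N%:R)) => // e e0.
have e20 : 0 < e / 2 by rewrite divr_gt0.
have [K K0 HK] := MPLE_beta_tight q0 Acpl D0 AD b0 potts_Uinv_oP e20.
exists (K / eta ^+ 2); apply: filterS2 HK (HU _ e20) => N h1 h2.
have -> : e = e / 2 + e / 2 by lra.
apply: le_trans (lerD h1 h2); apply: le_trans (prob_setU_le (@P0 N) _ _).
apply: le_prob => // x /= bad; apply/not_notP => /not_orP[/contrapT[ex hx] /negP].
rewrite -leNgt => Ueta; apply: bad; have := hx _ (hb _ _ ex).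
rewrite ler_pdivlMr ?exprn_gt0// => /(le_trans _); apply.
by rewrite -mulrA ler_wpM2l// ler_wpM2l// sqrtr_ge0.
Qed.

End Consistency.

(** A real [theta] strictly below the lower limit, which is extended-real, turns the hypothesis on
    the mass into an eventual bound; when [B = 0] it is taken with [b * theta] still above
    [beta_c]. *)
Lemma fixed_coupling_rates (R : realType) (q : nat) (hq : (2 <= q)%N)
    (A : forall N, 'M[R]_N) :
  (forall N, is_coupling (A N)) ->
  (ereal_sup [set \big[maxe/-oo]_(i < N) (\sum_j A N i j)%:E
             | N in [set N | (1 <= N)%N]] < +oo)%E ->
  (0 < limn_einf (fun N => (mxtotal (A N) / N%:R)%:E))%E ->
  forall (b : R) (B : 'rV[R]_q.-1), 0 < b ->
  B <> 0 \/
     (B = 0 /\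
      ((beta_c R q)%:E
         < b%:E * limn_einf (fun N => (mxtotal (A N) / N%:R)%:E))%E) ->
  exists2 eta : R, 0 < eta &
  forall e : R, 0 < e -> \forall N \near \oo,
    prob (potts (A N) b B) [set x : config q N | potts_U (A N) x < eta ^+ 2] <= e.
Proof.
move=> Acpl /(row_sums_bounded Acpl)[D D0 AD] L0 b B b0.
set L := limn_einf _ in L0 *.
have massP l : (l%:E < L)%E -> \forall N \near \oo, l <= mxtotal (A N) / N%:R.
  exact: limn_einf_gt_near.
case=> [B0|[-> bL]].
- have [theta theta0 thetaL] : exists2 theta : R, 0 < theta & (theta%:E < L)%E.
    move: L0; case: (L) => [r| |]//=; last by exists 1 => //; rewrite ltry.
    by rewrite lte_fin => r0; exists (r / 2); rewrite ?lte_fin; lra.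
  exact: (potts_U_lower_field (ltnW hq) Acpl D0 AD b0 theta0 (massP _ thetaL)).
have [theta thetab thetaL] : exists2 theta : R, beta_c R q < b * theta & (theta%:E < L)%E.
  move: bL L0; case: (L) => [r| |]//=; last first.
    move=> _ _; exists (beta_c R q / b + 1); rewrite ?ltry//.
    by rewrite mulrDr mulrCA divff ?gt_eqF// !mulr1 ltrDl.
  rewrite -EFinM !lte_fin => bL _; exists ((beta_c R q / b + r) / 2).
    have : b * (beta_c R q / b) = beta_c R q by rewrite mulrCA divff ?gt_eqF// mulr1.
    by nra.
  have : beta_c R q / b < r by rewrite ltr_pdivrMr// mulrC.
  by rewrite lte_fin; lra.
exact: potts_U_lower_supercritical (massP _ thetaL).
Qed.

(** * The Erdos-Renyi model *)

Section PairSums.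
Variables (R : realType) (N : nat).

Lemma sum_sym_edges (f : 'I_N -> 'I_N -> R) : (forall i j, f i j = f j i) ->
  \sum_i \sum_j f i j = \sum_i f i i + 2 * \sum_(e : edge N) f (\val e).1 (\val e).2.
Proof.
move=> fsym.
have <- : \sum_(z : 'I_N * 'I_N | (z.1 < z.2)%N) f z.1 z.2 =
    \sum_(e : edge N) f (\val e).1 (\val e).2.
  exact: (big_sub (fun z : 'I_N * 'I_N => (z.1 < z.2)%N) (fun z => f z.1 z.2)).
have lt_gt : \sum_(z : 'I_N * 'I_N | (z.2 < z.1)%N) f z.1 z.2 =
    \sum_(z : 'I_N * 'I_N | (z.1 < z.2)%N) f z.1 z.2.
  pose sw (z : 'I_N * 'I_N) := (z.2, z.1); have swK : involutive sw by case.
  rewrite (reindex_inj (inv_inj swK))/=.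
  by apply: eq_bigr => z _; rewrite fsym.
have diag : \sum_(z : 'I_N * 'I_N | z.1 == z.2) f z.1 z.2 = \sum_i f i i.
  rewrite -(pair_big_dep xpredT (fun i j => i == j) f)/=; apply: eq_bigr => i _.
  by rewrite (big_pred1 i)// => j; rewrite /= eq_sym.
rewrite pair_bigA/= (bigID (fun z => z.1 == z.2))/= diag; congr (_ + _).
rewrite (bigID (fun z : 'I_N * 'I_N => (z.1 < z.2)%N))/=.
rewrite (eq_bigl (fun z : 'I_N * 'I_N => (z.1 < z.2)%N)) => [|z]; last first.
  by rewrite andb_idl// => /ltn_eqF/negbT; rewrite -val_eqE.
rewrite [X in _ + X](eq_bigl (fun z : 'I_N * 'I_N => (z.2 < z.1)%N)) => [|z]; last first.
  by rewrite -leqNgt ltn_neqAle eq_sym -val_eqE.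
by rewrite lt_gt; ring.
Qed.

Lemma card_edge : 2 * #|edge N|%:R = N%:R ^+ 2 - N%:R :> R.
Proof.
have := @sum_sym_edges (fun _ _ => 1) (fun _ _ => erefl).
under eq_bigr do rewrite sumr_const card_ord.
by rewrite !sumr_const !card_ord -mulrnA natrM expr2 => ->; rewrite addrAC subrr add0r.
Qed.

Lemma adj_edge (G : graph N) (e : edge N) : adj G (\val e).1 (\val e).2 = G e.
Proof.
rewrite /adj -surjective_pairing valK/= insubF ?orbF//=.
by apply/negbTE; rewrite -leqNgt ltnW//; exact: (valP e).
Qed.

Lemma adj_sym (G : graph N) i j : adj G i j = adj G j i.
Proof. exact: orbC. Qed.

Lemma adj_diag (G : graph N) i : adj G i i = false.
Proof. by rewrite /adj insubF ?ltnn. Qed.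

End PairSums.

Section ERLaw.
Variables (R : realType) (N : nat) (p : R).
Hypothesis p01 : 0 < p <= 1.

Let p0 : 0 < p. Proof. by case/andP: p01. Qed.
Let p1 : p <= 1. Proof. by case/andP: p01. Qed.

Lemma ER_ge0 (G : graph N) : 0 <= ER p G.
Proof. by apply: prodr_ge0 => e _; case: ifP => _; rewrite ?subr_ge0// ltW. Qed.

(** Independence of the edges: the mean of a product over edges factorizes. Factors equal to [1] off
    a few edges give joint moments. *)
Lemma ER_prod (f : edge N -> bool -> R) :
  \sum_G ER p G * \prod_e f e (G e) = \prod_e (p * f e true + (1 - p) * f e false).
Proof.
have -> : \prod_e (p * f e true + (1 - p) * f e false) =
    \prod_e \sum_(c : bool) (if c then p else 1 - p) * f e c.
  by apply: eq_bigr => e _; rewrite big_bool.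
by rewrite bigA_distr_bigA/=; apply: eq_bigr => G _; rewrite /ER -big_split.
Qed.

Lemma ER_sum1 : \sum_G ER (N := N) p G = 1.
Proof.
have := ER_prod (fun _ _ => 1); rewrite [RHS]big1 => [<-|e _]; last by ring.
by apply: eq_bigr => G _; rewrite big1 ?mulr1.
Qed.

Lemma ER_edge_variance :
  \sum_G ER p G * (\sum_(e : edge N) ((G e)%:R - p)) ^+ 2 <= #|edge N|%:R.
Proof.
have one (G : graph N) (e : edge N) (X : bool -> R) :
    \prod_e' (if e' == e then X (G e') else 1) = X (G e).
  by rewrite -big_mkcond big_pred1_eq.
have cov (e e' : edge N) : \sum_G ER p G * (((G e)%:R - p) * ((G e')%:R - p)) <= (e == e')%:R.
  have [<-|ee'] := eqVneq e e'.
    apply: (@le_trans _ _ (\sum_G ER (N := N) p G)); last by rewrite ER_sum1.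
    apply: ler_sum => G _; rewrite ler_piMr ?ER_ge0// -expr2.
    by have := p0; have := p1; case: (G e) => /=; nra.
  pose f e'' (c : bool) := (if e'' == e then c%:R - p else 1) * (if e'' == e' then c%:R - p else 1).
  rewrite (eq_bigr (fun G => ER p G * \prod_e'' f e'' (G e''))); last first.
    by move=> G _; rewrite big_split/= !(one G _ (fun c => c%:R - p)).
  have fe : p * f e true + (1 - p) * f e false = 0.
    by rewrite /f eqxx (negPf ee') /=; ring.
  by rewrite ER_prod (bigD1 e)//= fe mul0r.
rewrite (eq_bigr (fun G => \sum_e \sum_e' ER p G * (((G e)%:R - p) * ((G e')%:R - p)))); last first.
  move=> G _; rewrite expr2 mulr_suml mulr_sumr; apply: eq_bigr => e _.
  by rewrite !mulr_sumr.
rewrite exchange_big/=; under eq_bigr do rewrite exchange_big/=.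
apply: (@le_trans _ _ (\sum_(e : edge N) \sum_e' (e == e')%:R)).
  by apply: ler_sum => e _; apply: ler_sum => e' _; exact: cov.
rewrite (eq_bigr (fun=> 1)) ?sumr_const// => e _.
by rewrite (bigD1 e)//= eqxx big1 ?addr0// => e'; rewrite eq_sym => /negPf ->.
Qed.

Lemma ER_coupling_sum (G : graph N) (f : 'I_N -> 'I_N -> R) :
  (forall i j, f i j = f j i) ->
  \sum_i \sum_j ER_coupling p G i j * f i j =
  2 / (N%:R * p) * \sum_(e : edge N) (G e)%:R * f (\val e).1 (\val e).2.
Proof.
move=> fsym; rewrite (@sum_sym_edges _ _ (fun i j => ER_coupling p G i j * f i j)); last first.
  by move=> i j; rewrite !mxE adj_sym fsym.
rewrite big1 ?add0r => [|i _]; last by rewrite mxE adj_diag !mul0r.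
rewrite -mulrA; congr (_ * _); rewrite mulr_sumr; apply: eq_bigr => e _.
by rewrite mxE adj_edge; ring.
Qed.

Lemma mxtotal_ER (G : graph N) : mxtotal (ER_coupling p G) =
  2 / (N%:R * p) * \sum_(e : edge N) (G e)%:R.
Proof.
have := @ER_coupling_sum G (fun _ _ => 1) (fun _ _ => erefl).
under eq_bigr do under eq_bigr do rewrite mulr1.
by under [X in _ = _ * X]eq_bigr do rewrite mulr1.
Qed.

(** The absent diagonal gives a bias [- 1 / N], and the order [N ^ 2] of independent edges gives a
    variance of order [1 / N ^ 2], which is summable. *)
Lemma ER_mass_second_moment : (0 < N)%N ->
  \sum_(G : graph N) ER p G * (mxtotal (ER_coupling p G) / N%:R - 1) ^+ 2 <=
  (8 / p ^+ 2 + 2) / N%:R ^+ 2.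
Proof.
move=> N0; have N0' : 0 < N%:R :> R by rewrite ltr0n.
pose X (G : graph N) := \sum_(e : edge N) ((G e)%:R - p).
have massE (G : graph N) : mxtotal (ER_coupling p G) / N%:R - 1 = 2 / (N%:R ^+ 2 * p) * X G - N%:R^-1.
  rewrite mxtotal_ER /X sumrB sumr_const -[p *+ _]mulr_natr.
  have -> : #|edge N|%:R = (N%:R ^+ 2 - N%:R) / 2 :> R by have := card_edge R N; lra.
  by field; rewrite !gt_eqF.
have sq_le (G : graph N) : (mxtotal (ER_coupling p G) / N%:R - 1) ^+ 2 <=
    8 / (N%:R ^+ 4 * p ^+ 2) * X G ^+ 2 + 2 / N%:R ^+ 2.
  rewrite massE; set c := 2 / _; set d := N%:R^-1.
  have -> : 8 / (N%:R ^+ 4 * p ^+ 2) = 2 * c ^+ 2 by rewrite /c; field; rewrite !gt_eqF.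
  have -> : 2 / N%:R ^+ 2 = 2 * d ^+ 2 by rewrite /d exprVn.
  by have := sqr_ge0 (c * X G + d); nra.
apply: (@le_trans _ _ (\sum_(G : graph N) ER p G * (8 / (N%:R ^+ 4 * p ^+ 2) * X G ^+ 2 + 2 / N%:R ^+ 2))).
  by apply: ler_sum => G _; rewrite ler_wpM2l ?ER_ge0.
under eq_bigr do rewrite mulrDr mulrCA.
rewrite big_split/= -mulr_sumr -mulr_suml ER_sum1 mul1r [leRHS]mulrDl lerD2r.
have c0 : 0 <= 8 / (N%:R ^+ 4 * p ^+ 2) by rewrite divr_ge0// mulr_ge0 ?exprn_ge0// ltW.
apply: le_trans (ler_wpM2l c0 ER_edge_variance) _.
have -> : 8 / p ^+ 2 / N%:R ^+ 2 = 8 / (N%:R ^+ 4 * p ^+ 2) * N%:R ^+ 2.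
  by field; rewrite !gt_eqF.
by rewrite ler_wpM2l//; have := card_edge R N; nra.
Qed.

End ERLaw.

(** * Exponential moments of colour counts under the uniform law *)

Section UniformSquareExponential.
Variables (R : realType) (q N : nat).
Hypothesis q0 : (0 < q)%N.

Let q0' : 0 < q%:R :> R. Proof. by rewrite ltr0n. Qed.

(** Restricted to the first [k] spins, so that spins can be added one at a time. *)
Definition colour_excess (k : nat) (x : config q N) (r : 'I_q) : R :=
  \sum_(i < N | (i < k)%N) ((x i == r)%:R - q%:R^-1).

Lemma colour_excess_sum0 k x : \sum_r colour_excess k x r = 0.
Proof.
rewrite exchange_big/= big1// => i _; rewrite sumrB sumr_const card_ord.
rewrite (bigD1 (x i))//= eqxx big1 => [|r]; last by rewrite eq_sym => /negPf ->.
by rewrite addr0 -[_ *+ q]mulr_natl divff ?subrr// gt_eqF.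
Qed.

Lemma colour_excess_upd k (kN : (k < N)%N) x s r :
  colour_excess k.+1 (upd x (Ordinal kN) s) r =
  colour_excess k x r + ((s == r)%:R - q%:R^-1).
Proof.
rewrite /colour_excess (bigD1 (Ordinal kN))//= upd_same addrC; congr (_ + _).
apply: eq_big => [i|i /andP[_ ik]]; last by rewrite upd_other.
rewrite -val_eqE/= ltnS; case: (ltngtP i k) => //.
Qed.

Lemma colour_excess_sqr_upd k (kN : (k < N)%N) x s :
  \sum_r colour_excess k.+1 (upd x (Ordinal kN) s) r ^+ 2 <=
  \sum_r colour_excess k x r ^+ 2 + 2 * colour_excess k x s + 1.
Proof.
under eq_bigr do rewrite colour_excess_upd.
set S := colour_excess k x.
have pick1 : \sum_r (s == r)%:R = 1 :> R.
  by have := sum_pick (fun=> 1 : R) s; under eq_bigr do rewrite mul1r.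
have -> : \sum_r (S r + ((s == r)%:R - q%:R^-1)) ^+ 2 =
   \sum_r S r ^+ 2 + 2 * S s + (1 - q%:R^-1).
  rewrite (eq_bigr (fun r => S r ^+ 2 + 2 * (S r * (s == r)%:R) - 2 * q%:R^-1 * S r
      + (1 - 2 * q%:R^-1) * (s == r)%:R + q%:R^-1 ^+ 2)); last first.
    by move=> r _; case: (s == r); rewrite /=; ring.
  rewrite !big_split/= sumrN -!mulr_sumr colour_excess_sum0 mulr0 subr0 sum_pick.
  rewrite pick1 sumr_const card_ord -[q%:R^-1 *+ q]mulr_natl.
  by field; rewrite gt_eqF.
by rewrite lerD2l gerBl invr_ge0 ltW.
Qed.

(** Averaging over one more spin replaces [lam] by [lam + 8 * lam ^+ 2] and
    costs a factor [expR lam]. *)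
Lemma uniform_sqr_exp k (lam : R) : (k <= N)%N -> 0 <= lam -> 16 * k%:R * lam <= 1 ->
  \sum_x expR (lam * \sum_r colour_excess k x r ^+ 2) <=
  q%:R ^+ N * expR (2 * k%:R * lam).
Proof.
elim: k lam => [|k IH] lam kN lam0 klam.
  rewrite (eq_bigr (fun=> 1)) => [|x _]; last first.
    rewrite big1 ?mulr0 ?expR0// => r _; rewrite /colour_excess big_pred0 ?expr0n//.
  by rewrite sumr_const card_ffun !card_ord mulr0 mul0r expR0 mulr1 natrX.
pose mu := lam + 8 * lam ^+ 2.
rewrite -(ler_pM2l q0') -(sum_upd _ (Ordinal kN)).
have step x : \sum_s expR (lam * \sum_r colour_excess k.+1 (upd x (Ordinal kN) s) r ^+ 2)
    <= q%:R * (expR lam * expR (mu * \sum_r colour_excess k x r ^+ 2)).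
  set S := colour_excess k x; set V := \sum_r S r ^+ 2.
  (* By [expR_le_gauss] the new spin enters linearly outside the exponential, and this term sums to
     zero over its colour [s]. *)
  apply: (@le_trans _ _ (\sum_s expR (lam * V + lam) * (2 * lam * S s + expR (8 * lam ^+ 2 * V)))).
    apply: ler_sum => s _.
    apply: (@le_trans _ _ (expR (lam * V + lam) * expR (2 * lam * S s))).
      rewrite -expRD ler_expR.
      by have := ler_wpM2l lam0 (colour_excess_sqr_upd kN x s); rewrite -/S -/V; lra.
    rewrite ler_wpM2l ?expR_ge0//; apply: le_trans (expR_le_gauss _) _.
    rewrite lerD2l ler_expR.
    have : S s ^+ 2 <= V by rewrite /V (bigD1 s)//= lerDl sumr_ge0// => r _; exact: sqr_ge0.
    by have := sqr_ge0 lam; nra.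
  rewrite -mulr_sumr big_split/= -mulr_sumr colour_excess_sum0 mulr0 add0r.
  rewrite sumr_const card_ord -[_ *+ q]mulr_natl mulrCA -expRD -expRD.
  by rewrite ler_wpM2l ?(ltW q0')// ler_expR /mu; lra.
apply: le_trans (ler_sum _ (fun x _ => step x)) _.
rewrite -!mulr_sumr ler_wpM2l ?(ltW q0')//.
have k0 : 0 <= k%:R :> R by [].
move: klam; rewrite -natr1 => klam.
have mu0 : 0 <= mu by rewrite /mu; have := sqr_ge0 lam; lra.
(* The condition reproduces itself: [16 * k * mu <= 16 * k * lam + 8 * lam <= 16 * (k + 1) *
   lam]. *)
have kmu : 16 * k%:R * mu <= 1.
  have : 8 * lam <= 1 by nra.
  have : 128 * k%:R * lam * lam <= 8 * lam by nra.
  rewrite /mu; nra.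
apply: le_trans (ler_wpM2l (expR_ge0 _) (IH mu (ltnW kN) mu0 kmu)) _.
rewrite mulrCA ler_wpM2l ?exprn_ge0// -expRD ler_expR /mu.
nra.
Qed.

End UniformSquareExponential.

(** * Comparison of the random-graph model with its infinite-temperature law *)

Section ERPottsOverlap.
Variables (R : realType) (q : nat) (p : R).
Hypothesis q0 : (0 < q)%N.
Hypothesis p01 : 0 < p <= 1.

Let p0 : 0 < p. Proof. by case/andP: p01. Qed.
Let q0' : 0 < q%:R :> R. Proof. by rewrite ltr0n. Qed.

Definition centred_agreement N (x : config q N) (i j : 'I_N) : R :=
  (x i == x j)%:R - q%:R^-1.

Lemma centred_agreement_sym N (x : config q N) i j :
  centred_agreement x i j = centred_agreement x j i.
Proof. by rewrite /centred_agreement eq_sym. Qed.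

Lemma centred_agreement_norm_le N (x : config q N) i j : `|centred_agreement x i j| <= 1.
Proof.
have : 0 < (q%:R^-1 : R) <= 1 by rewrite invr_gt0 q0' invf_le1// ler1n.
by rewrite /centred_agreement ler_norml; case: (_ == _) => /=; lra.
Qed.

(** Each term is the inner product of the indicator vectors of two colours, both centred by [1 / q];
    the double sum is a squared norm. *)
Lemma sum_centred_agreement N (x : config q N) :
  \sum_i \sum_j centred_agreement x i j = \sum_r colour_excess R N x r ^+ 2.
Proof.
have exE r : colour_excess R N x r = \sum_i ((x i == r)%:R - q%:R^-1).
  by apply: eq_bigl => i; rewrite ltn_ord.
under [RHS]eq_bigr do rewrite exE expr2 mulr_suml.
rewrite [RHS]exchange_big/=; apply: eq_bigr => i _.
under [RHS]eq_bigr do rewrite mulr_sumr.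
rewrite [RHS]exchange_big/=; apply: eq_bigr => j _.
rewrite (eq_bigr (fun r => (x i == r)%:R * (x j == r)%:R - q%:R^-1 * (x i == r)%:R
    - q%:R^-1 * (x j == r)%:R + q%:R^-1 * q%:R^-1)); last by move=> r _; ring.
have pick1 k : \sum_r (x k == r)%:R = 1 :> R.
  by have := sum_pick (fun=> 1 : R) (x k); under eq_bigr do rewrite mul1r.
rewrite !big_split/= !sumrN -!mulr_sumr !pick1 sum_pick sumr_const card_ord.
by rewrite -[q%:R^-1 *+ q]mulr_natl (divff (lt0r_neq0 q0')) /centred_agreement eq_sym; ring.
Qed.

Lemma sum_edges_centred_agreement N (x : config q N) :
  2 * \sum_(e : edge N) centred_agreement x (\val e).1 (\val e).2 =
  \sum_r colour_excess R N x r ^+ 2 - N%:R * (1 - q%:R^-1).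
Proof.
rewrite -sum_centred_agreement (sum_sym_edges (@centred_agreement_sym N x)).
have -> : \sum_i centred_agreement x i i = N%:R * (1 - q%:R^-1).
  under eq_bigr do rewrite /centred_agreement eqxx.
  by rewrite sumr_const card_ord mulr_natl.
by rewrite addrAC subrr add0r.
Qed.

Definition centred_energy N (x : config q N) (G : graph N) : R :=
  2^-1 * \sum_i \sum_j ER_coupling p G i j * centred_agreement x i j.

Lemma centred_energy_edges N (x : config q N) (G : graph N) :
  centred_energy x G =
  \sum_(e : edge N) (G e)%:R * (centred_agreement x (\val e).1 (\val e).2 / (N%:R * p)).
Proof.
rewrite /centred_energy ER_coupling_sum; last exact: centred_agreement_sym.
rewrite mulrA mulr_sumr; apply: eq_bigr => e _.
by rewrite mulrA mulVf ?mul1r 1?mulrC ?mulrA.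
Qed.

Lemma potts_ER N (G : graph N) b (x : config q N) :
  potts (ER_coupling p G) b 0 x =
  expR (b * centred_energy x G) / \sum_(y : config q N) expR (b * centred_energy y G).
Proof.
pose K := expR (b / 2 * (mxtotal (ER_coupling p G) * q%:R^-1)).
have wE y : potts_weight (ER_coupling p G) b (0 : 'rV_q.-1) y = K * expR (b * centred_energy y G).
  rewrite -expRD; congr expR; rewrite [X in _ + X]big1 ?addr0 => [|i _]; last first.
    by rewrite big1// => r _; rewrite /ext_field; case: insubP => [k _ _|_]; rewrite ?mxE mul0r.
  rewrite /centred_energy [b * (2^-1 * _)]mulrA -mulrDr; congr (_ * _).
  rewrite /mxtotal mulr_suml -big_split/=; apply: eq_bigr => i _.
  by rewrite mulr_suml -big_split/=; apply: eq_bigr => j _; rewrite /centred_agreement; ring.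
rewrite /potts /potts_Z wE; under eq_bigr do rewrite wE.
by rewrite -mulr_sumr -mulf_div divff ?mul1r// gt_eqF ?expR_gt0.
Qed.

Definition overlap_const : R := expR (2 / p + 1).

(** Each edge contributes at most [expR (p * (u + 2 * u ^+ 2))]. The linear parts assemble into the
    squared colour excess over [N]; the quadratic parts, at most [N ^ 2] of size about
    [p / (N * p) ^ 2], cost only [2 / p]. *)
Lemma centred_energy_mgf_fixed N (x : config q N) (t : R) :
  1 <= N%:R * p -> `|t| <= 8^-1 ->
  \sum_G ER p G * expR (t * centred_energy x G) <=
  expR (2 / p + 2^-1) * expR (`|t| / (2 * N%:R) * \sum_r colour_excess R N x r ^+ 2).
Proof.
move=> Np t8; have N0' : 0 < N%:R :> R.
  by rewrite lt_neqAle ler0n andbT; apply: contraTneq Np => <-; rewrite mul0r -ltNge ltr01.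
have Np0 : 0 < N%:R * p by rewrite mulr_gt0.
pose a (e : edge N) := centred_agreement x (\val e).1 (\val e).2.
pose u e := t * (a e / (N%:R * p)).
have u2 e : u e <= 2^-1.
  rewrite /u mulrA ler_pdivrMr//; have := centred_agreement_norm_le x (\val e).1 (\val e).2.
  rewrite -/(a e) => ha; apply: le_trans (ler_norm _) _; rewrite normrM.
  by have := ler_pM (normr_ge0 t) (normr_ge0 (a e)) t8 ha; lra.
rewrite (eq_bigr (fun G : graph N => ER p G * \prod_e (if G e then expR (u e) else 1))); last first.
  move=> G _; congr (_ * _); rewrite centred_energy_edges mulr_sumr expR_sum.
  apply: eq_bigr => e _; rewrite -/(a e) mulrCA -/(u e).
  by case: (G e); rewrite ?mul1r ?mul0r ?expR0.
rewrite (@ER_prod _ _ _ (fun e c => if c then expR (u e) else 1)).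
apply: (@le_trans _ _ (\prod_e expR (p * (u e + 2 * u e ^+ 2)))).
  apply: ler_prod => e _; rewrite mulr1; apply/andP; split.
    by rewrite addr_ge0 ?subr_ge0 ?mulr_ge0 ?expR_ge0 ?(ltW p0)//; case/andP: p01.
  apply: le_trans (expR_ge1Dx _); have := ler_wpM2l (ltW p0) (expR_le_quad (u2 e)).
  by lra.
rewrite -expR_sum -expRD ler_expR.
have -> : \sum_e p * (u e + 2 * u e ^+ 2) =
    t / (2 * N%:R) * (2 * \sum_e a e) + \sum_e 2 * p * u e ^+ 2.
  rewrite !mulr_sumr -big_split/=; apply: eq_bigr => e _; rewrite mulrDr; congr (_ + _).
    by rewrite /u; field; rewrite !gt_eqF.
  by ring.
rewrite sum_edges_centred_agreement; set S := \sum_r _.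
have S0 : 0 <= S by apply: sumr_ge0 => r _; exact: sqr_ge0.
have h1 : t / (2 * N%:R) * (S - N%:R * (1 - q%:R^-1)) <= `|t| / (2 * N%:R) * S + 2^-1.
  have -> : t / (2 * N%:R) * (S - N%:R * (1 - q%:R^-1)) =
      t / (2 * N%:R) * S - t / 2 * (1 - q%:R^-1) by field; rewrite !gt_eqF.
  have h2 : t / (2 * N%:R) * S <= `|t| / (2 * N%:R) * S.
    by rewrite ler_wpM2r// ler_wpM2r ?invr_ge0 ?mulr_ge0 ?(ltW N0')// ler_norm.
  have : 0 < (q%:R^-1 : R) <= 1 by rewrite invr_gt0 q0' invf_le1// ler1n.
  by move: t8; rewrite ler_norml; nra.
have h2 : \sum_(e : edge N) 2 * p * u e ^+ 2 <= 2 / p.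
  apply: (@le_trans _ _ (\sum_(e : edge N) 2 * p * (N%:R * p) ^- 2)).
    apply: ler_sum => e _; rewrite ler_wpM2l ?mulr_ge0 ?(ltW p0)//.
    rewrite /u mulrA expr_div_n -[leRHS]mul1r ler_wpM2r ?invr_ge0 ?exprn_ge0 ?(ltW Np0)//.
    rewrite -real_normK ?num_real// exprn_ile1// normrM.
    have := ler_pM (normr_ge0 t) (normr_ge0 (a e)) t8 (centred_agreement_norm_le x (\val e).1 (\val e).2).
    by lra.
  rewrite sumr_const -[_ *+ _]mulr_natl.
  have -> : 2 / p = N%:R ^+ 2 * (2 * p * (N%:R * p) ^- 2) by field; rewrite !gt_eqF.
  rewrite ler_wpM2r ?mulr_ge0 ?invr_ge0 ?exprn_ge0 ?(ltW Np0) ?(ltW p0)//.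
  have := card_edge R N; have := sqr_ge0 (N%:R : R); have := ler0n R #|edge N|; nra.
lra.
Qed.

(** Averages the previous bound over [x]. The limit [8^-1] is what [uniform_sqr_exp] demands at
    [k = N] and [lam] equal to the absolute value of [t] over [2 * N]. *)
Lemma centred_energy_mgf N (t : R) : 1 <= N%:R * p -> `|t| <= 8^-1 ->
  \sum_(x : config q N) \sum_G ER p G * expR (t * centred_energy x G) <= q%:R ^+ N * overlap_const.
Proof.
move=> Np t8; have N0' : 0 < N%:R :> R.
  by rewrite lt_neqAle ler0n andbT; apply: contraTneq Np => <-; rewrite mul0r -ltNge ltr01.
apply: le_trans (ler_sum _ (fun x _ => centred_energy_mgf_fixed x Np t8)) _.
rewrite -mulr_sumr.
have l0 : 0 <= `|t| / (2 * N%:R) by rewrite divr_ge0// mulr_ge0// ltW.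
have l1 : 16 * N%:R * (`|t| / (2 * N%:R)) <= 1.
  have -> : 16 * N%:R * (`|t| / (2 * N%:R)) = 8 * `|t| by field; rewrite gt_eqF.
  lra.
apply: le_trans (ler_wpM2l (expR_ge0 _) (uniform_sqr_exp q0 (leqnn N) l0 l1)) _.
rewrite mulrCA ler_wpM2l ?exprn_ge0 ?(ltW q0')// -expRD ler_expR.
have -> : 2 * N%:R * (`|t| / (2 * N%:R)) = `|t| by field; rewrite gt_eqF.
lra.
Qed.

Definition ER_uniform N (z : config q N * graph N) : R := ER p z.2 / q%:R ^+ N.

Lemma ER_uniform_ge0 N (z : config q N * graph N) : 0 <= ER_uniform z.
Proof. by rewrite divr_ge0 ?ER_ge0// exprn_ge0// ltW. Qed.

Lemma ER_uniform_sum1 N : \sum_(z : config q N * graph N) ER_uniform z = 1.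
Proof.
rewrite -(pair_bigA _ (fun x G => @ER_uniform N (x, G)))/= /ER_uniform/=.
under eq_bigr do rewrite -mulr_suml ER_sum1// mul1r.
rewrite sumr_const card_ffun !card_ord -[_ *+ _]mulr_natl natrX divff//.
by rewrite expf_neq0// gt_eqF.
Qed.

Lemma ER_uniform_sum N (F : config q N -> graph N -> R) :
  \sum_(z : config q N * graph N) ER_uniform z * F z.1 z.2 =
  (\sum_x \sum_G ER p G * F x G) / q%:R ^+ N.
Proof.
rewrite -(pair_bigA _ (fun x G => @ER_uniform N (x, G) * F x G))/= /ER_uniform/=.
rewrite mulr_suml; apply: eq_bigr => x _; rewrite mulr_suml; apply: eq_bigr => G _.
by rewrite mulrAC.
Qed.

(** Where the tilted density and its normalisation are both controlled, the
    model dominates a multiple of the [b = 0] model; exponential moments of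
    both signs bound the complement. *)
Lemma ER_potts_ge_uniform (b : R) : 0 < b <= 8^-1 -> exists2 c : R, 0 < c &
  \forall N \near \oo, forall E : set (config q N * graph N),
    c * (prob (@ER_uniform N) E - 4^-1) <= prob (ER_potts p b (0 : 'rV_q.-1)) E.
Proof.
move=> /andP[b0 b8]; set C := overlap_const; have C0 : 0 < C by exact: expR_gt0.
(* One factor comes from the lower bound on the density [w], one from the upper bound on its
   normalization [Zb]. *)
exists ((8 * C) ^- 2); first by rewrite invr_gt0 exprn_gt0// mulr_gt0.
near=> N => E.
have Np : 1 <= N%:R * p.
  by rewrite -ler_pdivrMr// mul1r; near: N; exact: nbhs_infty_ger.
have qN0 : 0 < q%:R ^+ N :> R by rewrite exprn_gt0.
pose w (x : config q N) G := expR (b * centred_energy x G).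
pose Zb G := (\sum_x w x G) / q%:R ^+ N.
have w0 x G : 0 < w x G by exact: expR_gt0.
have Zb0 G : 0 < Zb G.
  rewrite divr_gt0// (bigD1 [ffun=> Ordinal q0])//= ltr_pwDl//.
  by apply: sumr_ge0 => x _; exact: ltW.
have C80 : 0 < 8 * C by rewrite mulr_gt0.
(* On [B1] the density is too small, on [B2] the normalization too large. Both mean values are at
   most [C], so Markov gives [8^-1] each and [4^-1] in all. *)
pose B1 := [set z : config q N * graph N | 8 * C <= (w z.1 z.2)^-1].
pose B2 := [set z : config q N * graph N | 8 * C <= Zb z.2].
have tb : `|b| <= 8^-1 by rewrite gtr0_norm.
have tNb : `|- b| <= 8^-1 by rewrite normrN.
have hB1 : prob (@ER_uniform N) B1 <= 8^-1.
  apply: le_trans (@prob_markov _ _ _ (@ER_uniform_ge0 N) B1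
    (fun z => (w z.1 z.2)^-1) (8 * C) C80 _ _) _ => //.
    by move=> z; rewrite invr_ge0 ltW.
  rewrite (ER_uniform_sum (fun x G => (w x G)^-1)) ler_pdivrMr// ler_pdivrMr//.
  have := centred_energy_mgf Np tNb; rewrite -/C.
  under eq_bigr do under eq_bigr do rewrite mulNr expRN.
  by rewrite -/w; lra.
have hB2 : prob (@ER_uniform N) B2 <= 8^-1.
  apply: le_trans (@prob_markov _ _ _ (@ER_uniform_ge0 N) B2
    (fun z => Zb z.2) (8 * C) C80 _ _) _ => //.
    by move=> z; exact: ltW.
  rewrite (ER_uniform_sum (fun _ G => Zb G)) ler_pdivrMr// ler_pdivrMr//.
  have := centred_energy_mgf Np tb; rewrite -/C exchange_big/=.
  have -> : \sum_(x : config q N) \sum_G ER p G * Zb G = \sum_G \sum_x ER p G * w x G.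
    rewrite sumr_const card_ffun !card_ord -[_ *+ _]mulr_natl natrX mulr_sumr.
    apply: eq_bigr => G _; rewrite -mulr_sumr /Zb mulrCA; congr (_ * _).
    by rewrite mulrCA divff ?mulr1// gt_eqF.
  by rewrite -/w; lra.
have c0 : 0 <= (8 * C) ^- 2 by rewrite invr_ge0 exprn_ge0// ltW.
have key : (8 * C) ^- 2 * (prob (@ER_uniform N) E - prob (@ER_uniform N) B1
    - prob (@ER_uniform N) B2) <= prob (ER_potts p b (0 : 'rV_q.-1)) E.
  rewrite !probE -!sumrB mulr_sumr; apply: ler_sum => -[x G] _.
  set Qz := ER_uniform _; have Qz0 : 0 <= Qz := ER_uniform_ge0 _.
  have Pz0 : 0 <= ER_potts p b (0 : 'rV_q.-1) (x, G).
    by rewrite mulr_ge0 ?ER_ge0// potts_ge0.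
  have -> : (8 * C) ^- 2 * (Qz * ((x, G) \in E)%:R - Qz * ((x, G) \in B1)%:R - Qz * ((x, G) \in B2)%:R)
    = (8 * C) ^- 2 * Qz * (((x, G) \in E)%:R - ((x, G) \in B1)%:R - ((x, G) \in B2)%:R) by ring.
  have cQ0 : 0 <= (8 * C) ^- 2 * Qz by rewrite mulr_ge0.
  have neg (y : R) (c : bool) : y <= 0 ->
      (8 * C) ^- 2 * Qz * y <= ER_potts p b (0 : 'rV_q.-1) (x, G) * c%:R.
    by move=> y0; apply: (@le_trans _ _ 0); [exact: mulr_ge0_le0|exact: mulr_ge0].
  have [zE|zE] := boolP ((x, G) \in E); last first.
    by apply: neg; rewrite sub0r -opprD oppr_le0 addr_ge0.
  have [zB1|zB1] := boolP ((x, G) \in B1); first by apply: neg; rewrite subrr sub0r oppr_le0.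
  have [zB2|zB2] := boolP ((x, G) \in B2); first by apply: neg; rewrite subr0 subrr.
  rewrite !subr0 !mulr1.
  move: zB1; rewrite notin_setE/= => /negP; rewrite -ltNge => hw.
  move: zB2; rewrite notin_setE/= => /negP; rewrite -ltNge => hZ.
  rewrite /ER_potts potts_ER /Qz /ER_uniform/=.
  have -> : \sum_y expR (b * centred_energy y G) = Zb G * q%:R ^+ N.
    by rewrite /Zb divfK// gt_eqF.
  rewrite -/(w x G).
  have -> : ER p G * (w x G / (Zb G * q%:R ^+ N)) = w x G / Zb G * (ER p G / q%:R ^+ N).
    by field; rewrite !gt_eqF.
  rewrite ler_wpM2r ?divr_ge0 ?ER_ge0 ?(ltW qN0)// expr2 invfM ler_pM ?invr_ge0 ?(ltW C80)//.
    by rewrite -[w x G]invrK lef_pV2 ?posrE ?invr_gt0// ltW.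
  by rewrite lef_pV2 ?posrE// ltW.
apply: le_trans key; rewrite ler_wpM2l//; lra.
Unshelve. all: by end_near.
Qed.

Lemma ER_no_consistent_estimator (q2 : (2 <= q)%N) :
  ~ (exists est : forall N, config q N * graph N -> R,
      forall b : R, 0 < b < beta_c R q ->
        cvg_in_prob (T := fun N => (config q N * graph N)%type)
          (fun N => ER_potts p b (0 : 'rV[R]_q.-1)) est b).
Proof.
move=> [est hest]; have bc0 := @beta_c_gt0 R q q2.
pose b2 : R := Num.min 8^-1 (beta_c R q / 2).
have b20 : 0 < b2 by rewrite lt_min invr_gt0 divr_gt0// ltr0n.
have b28 : b2 <= 8^-1 by rewrite ge_min lexx.
have b2c : b2 <= beta_c R q / 2 by rewrite ge_min lexx orbT.
(* An error probability of [c / 8] in the model at [b] becomes [4^-1 + 8^-1] in the reference law.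
   The true values [b2] and [b2 / 2] are further apart than twice the tolerance, so the two error
   events cover everything, although their probabilities add up to at most [3 / 4]. *)
have small (b : R) : 0 < b <= b2 -> \forall N \near \oo,
    prob (@ER_uniform N) [set z | b2 / 8 < `|est N z - b|] <= 3 / 8.
  case/andP=> b0 bb2; have b8 : 0 < b <= 8^-1 by lra.
  have [c c0 hc] := ER_potts_ge_uniform b8.
  have bbc : 0 < b < beta_c R q by lra.
  have e0 : 0 < b2 / 8 by lra.
  have := hest b bbc _ e0; move/cvgrPdist_le => /(_ (c / 8)).
  move=> /(_ (divr_gt0 c0 (ltr0Sn _ _))) hP.
  apply: filterS2 hc hP => N /(_ [set z | b2 / 8 < `|est N z - b|]) h1 h2.
  have h3 : prob (ER_potts p b (0 : 'rV_q.-1)) [set z | b2 / 8 < `|est N z - b|] <= c / 8.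
    by move: h2; rewrite sub0r normrN => /(le_trans (ler_norm _)).
  by have := le_trans h1 h3; rewrite ler_pM2l//; lra.
have h1 : 0 < b2 <= b2 by lra.
have h2 : 0 < b2 / 2 <= b2 by lra.
have [N [hN1 hN2]] := filter_ex (filterI (small _ h1) (small _ h2)).
have := @prob_setU_le _ _ _ (@ER_uniform_ge0 N) [set z | b2 / 8 < `|est N z - b2|]
  [set z | b2 / 8 < `|est N z - b2 / 2|].
rewrite (_ : _ `|` _ = setT); last first.
  apply/seteqP; split=> // z _ /=; apply: contrapT => /not_orP[/negP + /negP].
  by rewrite -!leNgt !ler_norml; lra.
by rewrite prob_setT ER_uniform_sum1; lra.
Qed.

End ERPottsOverlap.

(** * Almost sure convergence of the mass *)

Section FiniteImage.
Variables (R : realType) (d : measure_display) (Omega : measurableType d).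
Variables (Q : probability Omega R) (T : finType) (Z : Omega -> T) (P : T -> R).
Hypothesis Zm : forall z, measurable (Z @^-1` [set z]).
Hypothesis ZP : forall z, Q (Z @^-1` [set z]) = (P z)%:E.

Lemma finite_image_measurable (E : set T) :
  measurable (Z @^-1` E) /\ (Q (Z @^-1` E) <= (prob P E)%:E)%E.
Proof.
have step (s : seq T) : measurable [set w | Z w \in s] /\
    (Q [set w | Z w \in s] <= (\sum_(z <- s) P z)%:E)%E.
  elim: s => [|z s [ms Qs]].
    rewrite big_nil (_ : mkset _ = set0) ?measure0//.
    by apply/seteqP; split => w.
  have -> : [set w | Z w \in z :: s] = Z @^-1` [set z] `|` [set w | Z w \in s].
    apply/seteqP; split => w /=; rewrite inE; first by case/orP => [/eqP|]; [left|right].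
    by case=> [->|->]; rewrite ?eqxx ?orbT.
  split; first exact: measurableU.
  rewrite big_cons EFinD; apply: le_trans (measureU2 _ (Zm z) ms) _.
  by apply: leeD => //; rewrite -ZP.
have := step (enum [pred z | z \in E]); rewrite big_enum_cond/=.
rewrite (_ : mkset _ = Z @^-1` E); last first.
  by apply/seteqP; split => w /=; rewrite mem_enum !inE.
by under eq_bigl do rewrite andbT.
Qed.

End FiniteImage.

(** The bounds telescope, so the probabilities have sum at most [K * v 0] and Borel-Cantelli
    applies. *)
Lemma negligible_lim_sup_telescoping (R : realType) (d : measure_display)
    (Omega : measurableType d) (Q : probability Omega R) (F : nat -> set Omega)
    (K : R) (v : nat -> R) :
  (forall N, measurable (F N)) -> (forall N, 0 <= v N) ->
  (forall N, (Q (F N) <= (K * (v N - v N.+1))%:E)%E) -> 0 <= K ->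
  Q.-negligible (lim_sup_set F).
Proof.
move=> Fm v0 QF K0; apply/negligibleP.
  by apply: bigcapT_measurable => n; exact: bigcup_measurable.
apply: lim_sup_set_cvg0 => //.
apply: (@le_lt_trans _ _ (K * v 0)%:E); last exact: ltry.
apply: lime_le; first by apply: is_cvg_nneseries => n _ _; exact: measure_ge0.
apply: nearW => n; apply: (@le_trans _ _ (\sum_(0 <= N < n) (K * (v N - v N.+1))%:E)%E).
  by apply: lee_sum => N _; exact: QF.
rewrite sumEFin lee_fin -mulr_sumr ler_wpM2l//.
have -> : \sum_(0 <= N < n) (v N - v N.+1) = v 0 - v n.
  rewrite -[RHS]opprB -telescope_sumr// -sumrN.
  by apply: eq_bigr => N _; rewrite opprB.
by rewrite gerBl.
Qed.

(** Only the law of each [Z N] is prescribed, not their joint law; the summable half of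
    Borel-Cantelli works under any coupling of them. Tolerances [1 / (k + 1)] give countably many
    null sets. *)
Lemma ER_mass_cvg_ae (R : realType) (q : nat) (q0 : (0 < q)%N) (p : R) :
  0 < p <= 1 -> forall (b : R) (B : 'rV[R]_q.-1)
    (d : measure_display) (Omega : measurableType d) (Q : probability Omega R)
    (Z : forall N, Omega -> config q N * graph N),
  (forall N z, measurable (Z N @^-1` [set z])) ->
  (forall N z, Q (Z N @^-1` [set z]) = (ER_potts p b B z)%:E) ->
  {ae Q, forall w,
    mxtotal (ER_coupling p (Z N w).2) / N%:R @[N --> \oo] --> (1 : R)}.
Proof.
move=> p01 b B d Omega Q Z Zm ZP; have p0 : 0 < p by case/andP: p01.
pose Y N (z : config q N * graph N) := mxtotal (ER_coupling p z.2) / N%:R - 1.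
pose F k N := Z N @^-1` [set z | k.+1%:R^-1 < `|Y N z|].
have P0 N (z : config q N * graph N) : 0 <= ER_potts p b B z.
  by rewrite mulr_ge0 ?ER_ge0// potts_ge0.
have Psum N (f : graph N -> R) :
    \sum_(z : config q N * graph N) ER_potts p b B z * f z.2 = \sum_G ER p G * f G.
  rewrite -(pair_bigA _ (fun x G => @ER_potts R q N p b B (x, G) * f G))/= exchange_big/=.
  apply: eq_bigr => G _; rewrite -mulr_suml /ER_potts/= -mulr_sumr.
  by rewrite potts_sum1// mulr1.
have Fm k N : measurable (F k N).
  by have [] := finite_image_measurable (Zm N) (ZP N) [set z | k.+1%:R^-1 < `|Y N z|].
pose C : R := 8 / p ^+ 2 + 2.
have C0 : 0 < C by rewrite ltr_wpDl// divr_ge0// exprn_ge0// ltW.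
(* The [6] comes from [(N + 1) * (N + 2) <= 6 * N ^ 2] for [1 <= N]; the summand [2] covers [N = 0],
   where the difference of inverses is [1 / 2]. *)
have QF k N : (Q (F k N) <= ((6 * C * k.+1%:R ^+ 2 + 2) * (N.+1%:R^-1 - N.+2%:R^-1))%:E)%E.
  have [_ /le_trans] := finite_image_measurable (Zm N) (ZP N) [set z | k.+1%:R^-1 < `|Y N z|].
  apply; rewrite lee_fin.
  have k0 : 0 < k.+1%:R :> R by rewrite ltr0n.
  have [->|N0] := posnP N.
    apply: (@le_trans _ _ 1).
      apply: prob_le1 => //; have := Psum 0%N (fun=> 1); under eq_bigr do rewrite mulr1.
      by move=> ->; under eq_bigr do rewrite mulr1; rewrite ER_sum1.
    have := mulr_gt0 C0 (exprn_gt0 2 k0); rewrite invr1; lra.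
  have N0' : 1 <= N%:R :> R by rewrite ler1n.
  apply: le_trans (@prob_markov _ _ _ (P0 N) _ (fun z => Y N z ^+ 2) (k.+1%:R ^- 2) _ _ _) _.
  - by rewrite invr_gt0 exprn_gt0.
  - by move=> z; exact: sqr_ge0.
  - move=> z /= /ltW hz; rewrite -[Y N z ^+ 2]real_normK ?num_real// -exprVn.
    by rewrite lerXn2r// nnegrE ltW// invr_gt0.
  rewrite (Psum N (fun G => (mxtotal (ER_coupling p G) / N%:R - 1) ^+ 2)) invrK.
  apply: le_trans (ler_wpM2r (exprn_ge0 2 (ltW k0)) (ER_mass_second_moment p01 N0)) _.
  rewrite -/C -!natr1; set n : R := N%:R in N0' *; set m := (k%:R + 1) ^+ 2.
  have m0 : 0 < m by rewrite /m natr1 exprn_gt0.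
  have -> : (n + 1)^-1 - (n + 1 + 1)^-1 = ((n + 1) * (n + 2))^-1 by field; lra.
  rewrite ler_pdivlMr; last by nra.
  rewrite mulrAC -mulrA mulrAC ler_pdivrMr ?exprn_gt0//; last by lra.
  have Cm := mulr_gt0 C0 m0.
  have : (n + 1) * (n + 2) <= 6 * n ^+ 2 by nra.
  move=> /(ler_wpM2l (ltW Cm)); have : 0 < n ^+ 2 by nra.
  nra.
apply: (negligibleS _ (negligible_bigcup (fun k =>
  @negligible_lim_sup_telescoping R d Omega Q (F k) (6 * C * k.+1%:R ^+ 2 + 2)
    (fun N => N.+1%:R^-1) (Fm k) _ (QF k) _))); last 2 first.
- by move=> k N; rewrite invr_ge0.
- by move=> k; rewrite addr_ge0// mulr_ge0 ?exprn_ge0// mulr_ge0// ltW.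
move=> w /= ncvg; apply: contrapT => H; apply: ncvg.
apply/cvgrPdist_le => e e0.
have [k /= ke] := filter_ex (@nbhs_infty_ger R e^-1).
have [n hn] : exists n, forall N, (n <= N)%N -> ~ F k N w.
  apply: contrapT => H'; apply: H; exists k => // n _.
  apply: contrapT => H''; apply: H'; exists n => N nN FN; apply: H''.
  by exists N.
exists n => // N /= /hn/negP; rewrite -leNgt distrC => /le_trans; apply.
rewrite -[leRHS]invrK lef_pV2 ?posrE ?invr_gt0// ?ltr0n//.
by apply: le_trans ke _; rewrite ler_nat.
Qed.

Theorem theorem1p7 (R : realType) (q : nat) (hq : (2 <= q)%N) :
  (forall A : forall N, 'M[R]_N,
    (forall N, is_coupling (A N)) ->
    (ereal_sup [set \big[maxe/-oo]_(i < N) (\sum_j A N i j)%:E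
               | N in [set N | (1 <= N)%N]] < +oo)%E ->
    (0 < limn_einf (fun N => (mxtotal (A N) / N%:R)%:E))%E ->
    forall (b : R) (B : 'rV[R]_q.-1), 0 < b ->
    let P := fun N => potts (q := q) (A N) b B in
    [/\ (* (a) *)
        prob (P N) [set x | MPLE_B_exists (A N) b x] @[N --> \oo] --> (1 : R)
        /\ (is_oP (T := config q) P (@potts_Uinv R q A) (fun N _ => (Num.sqrt N%:R)%:E) ->
            prob (P N) [set x | MPLE_beta_exists (A N) B x] @[N --> \oo]
              --> (1 : R)),
        (* (b) *)
        (forall Bhat : forall N, config q N -> 'rV[R]_q.-1,
          (forall N, is_MPLE_B (A N) b (Bhat N)) ->
          is_OP (T := config q) P (fun N x => (l2norm (Bhat N x - B))%:E)
                  (fun N _ => ((Num.sqrt N%:R)%:E^-1)%E)),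
        (* (c) *)
        (is_oP (T := config q) P (@potts_Uinv R q A) (fun N _ => (Num.sqrt N%:R)%:E) ->
         forall bhat : forall N, config q N -> R,
          (forall N, is_MPLE_beta (A N) B (bhat N)) ->
          is_OP (T := config q) P (fun N x => (`| bhat N x - b |)%:E)
                  (fun N x => ((Num.sqrt N%:R * potts_U (A N) x)%:E^-1)%E))
      & (* (d) *)
        (B <> 0 \/
         (B = 0 /\
          ((beta_c R q)%:E
             < b%:E * limn_einf (fun N => (mxtotal (A N) / N%:R)%:E))%E) ->
         is_OP (T := config q) P (@potts_Uinv R q A) (fun N _ => 1%E)
         /\ (forall bhat : forall N, config q N -> R,
              (forall N, is_MPLE_beta (A N) B (bhat N)) ->
              is_OP (T := config q) P (fun N x => (`| bhat N x - b |)%:E)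
                      (fun N _ => ((Num.sqrt N%:R)%:E^-1)%E)))])
  /\
  (* (e) *)
  (forall p : R, 0 < p <= 1 ->
    (forall (b : R) (B : 'rV[R]_q.-1), 0 < b ->
     forall (d : measure_display) (Omega : measurableType d)
            (Q : probability Omega R)
            (Z : forall N, Omega -> config q N * graph N),
       (forall N z, measurable (Z N @^-1` [set z])) ->
       (forall N z, Q (Z N @^-1` [set z]) = (ER_potts p b B z)%:E) ->
       {ae Q, forall w,
          mxtotal (ER_coupling p (Z N w).2) / N%:R @[N --> \oo] --> (1 : R)})
    /\
    ~ (exists est : forall N, config q N * graph N -> R,
        forall b : R, 0 < b < beta_c R q ->
          cvg_in_prob (T := fun N => (config q N * graph N)%type)
            (fun N => ER_potts p b (0 : 'rV[R]_q.-1)) est b)).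
Proof.
split=> [A Acpl Asup Ainf b B b0 P|p p01]; last first.
  split=> [b B b0 d Omega Q Z|]; first exact: ER_mass_cvg_ae (ltnW hq) _ p01 b B d Omega Q Z.
  exact: ER_no_consistent_estimator (ltnW hq) p01 hq.
have [D D0 AD] := row_sums_bounded Acpl Asup; have q0 := ltnW hq.
split.
- split; first exact: MPLE_B_exists_cvg q0 Acpl AD b0.
  exact: MPLE_beta_exists_cvg q0 Acpl D0 AD b0.
- exact: MPLE_B_rate q0 Acpl AD b0.
- by move=> UoP bhat hb; exact: (MPLE_beta_rate q0 Acpl D0 AD b0 UoP hb).
- move=> /(fixed_coupling_rates hq Acpl Asup Ainf b0) Ulow; split.
    exact: potts_Uinv_OP1 q0 Ulow.
  exact: MPLE_beta_sqrt_rate q0 Acpl D0 AD b0 Ulow.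
Qed.
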